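(* For all integers $n \geq 0$, \begin{align*} dp(6n+4) & \equiv 0 \pmod{2}, \\ dp(18n+10) & \equiv 0 \pmod{4}, \\ dp(54n+52) & \equiv 0 \pmod{8}. \end{align*}
   Context: A partition of a positive integer $n$ is a nonincreasing sequence of positive integers (called parts) whose sum is $n$. For $n\ge 0$, $dp(n)$ denotes the number of partitions of $n$ in which every part is either divisible by $4$ or congruent to $\pm 1 \pmod 6$ (with $dp(0)=1$). Equivalently, its generating function is $$\sum_{n=0}^{\infty} dp(n)q^n = \frac{1}{(q;q^6)_\infty (q^5;q^6)_\infty (q^4;q^4)_\infty},$$ where $(a;q)_\infty := (1-a)(1-aq)(1-aq^2)\cdots$. *)

(* Defs.v *)
From mathcomp Require Import all_boot.

Set Implicit Arguments.
Unset Strict Implicit.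
Unset Printing Implicit Defensive.

Definition is_partition (n : nat) (s : seq nat) : bool :=
  [&& sorted geq s, all (ltn 0) s & sumn s == n].

Definition dp_part (k : nat) : bool :=
  [|| 4 %| k, k == 1 %[mod 6] | k == 5 %[mod 6]].

(* A partition of n has at most n parts, each at most n, so the partitions of n
   are exactly the sequences [map val s] with s in the finite type
   {bseq n of 'I_n.+1}; see [is_partition_bseq]. *)
Definition dp (n : nat) : nat :=
  #|[set s : {bseq n of 'I_n.+1} |
      is_partition n (map val s) && all dp_part (map val s)]|.

Lemma is_partition_bseq (n : nat) (t : seq nat) :
  is_partition n t -> exists s : {bseq n of 'I_n.+1}, t = map val s.
Proof.
case/and3P=> _ tpos /eqP tsum.
have tsz : size t <= n.
  rewrite -{}tsum; elim: t tpos => //= x t IHt /andP[x0 /IHt le_t].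
  by rewrite -add1n leq_add.
have tle : all (fun k => k <= n) t.
  rewrite -{}tsum; apply/allP => x {tpos tsz}; elim: t => //= y t IHt.
  rewrite inE => /orP[/eqP->|/IHt le_x]; first exact: leq_addr.
  exact: leq_trans le_x (leq_addl _ _).
have sz : size (map (@inord n) t) <= n by rewrite size_map.
exists (Bseq sz); rewrite /= -map_comp -[LHS]map_id.
by apply/eq_in_map => x /(allP tle) le_x /=; rewrite inordK.
Qed.

(* Main.v *)
Require Import Defs.
From HB Require Import structures.
From mathcomp Require Import all_boot all_order all_algebra boolp.
From mathcomp Require Import zify ring.

(* Write f_k for the product of the 1 - q^(kn), n > 0, so that the generating
   function of dp is f_2 f_3 / (f_1 f_4 f_6), that is (q^3; q^6) / psi(-q).
   The Jacobi triple product gives psi(q) = f_2^2 / f_1, and splitting the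
   exponents of psi modulo 3 gives psi(q) = A(q^3) + q psi(q^9) with
   A = f(q, q^2).  Rationalising 1 / psi with respect to this splitting, the
   norm A^3 + q psi(q^3)^3 being computed from the multiplicativity of the norm
   and the product for psi, yields
     sum dp(3n+1) q^n = f_2 f_6^3 / (f_1^2 f_4^3).
   Since f_1^2 / f_2 = phi(-q) is 1 modulo 2, the part of odd degree is 2 H
   with H = f_2 f_3^3 f_4 modulo 4.  Finally f_1 f_2 = psi(q) phi(-q), whose
   3-dissection shows that the coefficients of H at 3n+1 are even, and that
   those at 3n+2 are generated modulo 4 by -f_1^3 f_6 f_12, hence by
   -psi(q) f_6 f_12, which has no exponent 2 modulo 3. *)

Set Implicit Arguments.
Unset Strict Implicit.
Unset Printing Implicit Defensive.

Import GRing.Theory.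

(** * Formal power series *)

Section PowerSeries.
Local Open Scope ring_scope.
Variable R : comNzRingType.

Record pseries := PSeries { coefs : nat -> R }.
Coercion coefs : pseries >-> Funclass.

Lemma pseriesP (f g : pseries) : (forall n, f n = g n) -> f = g.
Proof. by case: f g => f [g] /= /funext ->. Qed.

HB.instance Definition _ := gen_eqMixin pseries.
HB.instance Definition _ := gen_choiceMixin pseries.

(* Locking the constructor keeps [done] from evaluating convolutions when it
   tries to discriminate two series. *)
Definition mkps f : pseries := locked (PSeries f).

Lemma mkpsE f n : mkps f n = f n.
Proof. by rewrite /mkps -lock. Qed.

Definition ps_zero := mkps (fun=> 0).
Definition ps_opp f := mkps (fun n => - coefs f n).
Definition ps_add f g := mkps (fun n => coefs f n + coefs g n).

Fact ps_addA : associative ps_add.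
Proof. by move=> f g h; apply: pseriesP => n; rewrite !mkpsE addrA. Qed.
Fact ps_addC : commutative ps_add.
Proof. by move=> f g; apply: pseriesP => n; rewrite !mkpsE addrC. Qed.
Fact ps_add0 : left_id ps_zero ps_add.
Proof. by move=> f; apply: pseriesP => n; rewrite !mkpsE add0r. Qed.
Fact ps_addN : left_inverse ps_zero ps_opp ps_add.
Proof. by move=> f; apply: pseriesP => n; rewrite !mkpsE addNr. Qed.

HB.instance Definition _ :=
  GRing.isZmodule.Build pseries ps_addA ps_addC ps_add0 ps_addN.

Definition ps_one := mkps (fun n => (n == 0%N)%:R).
Definition ps_mul f g :=
  mkps (fun n => \sum_(i < n.+1) coefs f i * coefs g (n - i)).

Let trunc N f := \poly_(i < N) coefs f i.

(** The coefficients of a product below N only involve the coefficients of the factors below N, so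
    associativity and commutativity are inherited from polynomials. *)
Let coef_mul_trunc N f g n : (n < N)%N ->
  ps_mul f g n = (trunc N f * trunc N g)`_n.
Proof.
move=> nN; rewrite mkpsE coefM; apply: eq_bigr => i _; have := ltn_ord i => iN.
by rewrite !coef_poly !ifT //; lia.
Qed.

Fact ps_mulC : commutative ps_mul.
Proof.
move=> f g; apply: pseriesP => n.
by rewrite !(@coef_mul_trunc n.+1) // mulrC.
Qed.

Fact ps_mulA : associative ps_mul.
Proof.
have mulE f g h n : ps_mul (ps_mul f g) h n
    = (trunc n.+1 f * trunc n.+1 g * trunc n.+1 h)`_n.
  rewrite mkpsE coefM; apply: eq_bigr => i _.
  by rewrite (@coef_mul_trunc n.+1) // coef_poly ltnS leq_subr.
move=> f g h; apply: pseriesP => n.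
by rewrite mulE ps_mulC mulE mulrC mulrA.
Qed.

Fact ps_mul1 : left_id ps_one ps_mul.
Proof.
move=> f; apply: pseriesP => n; rewrite mkpsE big_ord_recl mkpsE mul1r subn0.
by rewrite big1 ?addr0 // => i _; rewrite mkpsE mul0r.
Qed.

Fact ps_mulDl : left_distributive ps_mul ps_add.
Proof.
move=> f g h; apply: pseriesP => n; rewrite !mkpsE -big_split /=.
by apply: eq_bigr => i _; rewrite mkpsE mulrDl.
Qed.

Fact ps_one_neq0 : ps_one != ps_zero.
Proof.
by apply/eqP => /(congr1 (fun f : pseries => f 0%N))/eqP; rewrite !mkpsE oner_eq0.
Qed.

HB.instance Definition _ := GRing.Zmodule_isComNzRing.Build pseries
  ps_mulA ps_mulC ps_mul1 ps_mulDl ps_one_neq0.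

Implicit Types (f g h : pseries).

Lemma coef0E n : (0 : pseries) n = 0.
Proof. exact: mkpsE. Qed.
Lemma coefDE f g n : (f + g) n = f n + g n.
Proof. exact: mkpsE. Qed.
Lemma coefNE f n : (- f) n = - f n.
Proof. exact: mkpsE. Qed.
Lemma coef1E n : (1 : pseries) n = (n == 0%N)%:R.
Proof. exact: mkpsE. Qed.
Lemma coefME f g n : (f * g) n = \sum_(i < n.+1) f i * g (n - i)%N.
Proof. exact: mkpsE. Qed.

Definition coefE := (coef0E, coefDE, coefNE, coef1E).

Lemma coef_sumE I (r : seq I) (P : pred I) (F : I -> pseries) n :
  (\sum_(i <- r | P i) F i) n = \sum_(i <- r | P i) F i n.
Proof. by apply: (big_morph (fun f => coefs f n)) => [f g|]; rewrite coefE. Qed.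

Lemma coefMnE f m n : (f *+ m) n = f n *+ m.
Proof. by elim: m => [|m IH]; rewrite ?coef0E // !mulrS coefDE IH. Qed.

Definition psX : pseries := mkps (fun n => (n == 1%N)%:R).

Lemma coef_psX n : psX n = (n == 1%N)%:R.
Proof. exact: mkpsE. Qed.

Lemma coef_psXM f n : (psX * f) n = if n is m.+1 then f m else 0.
Proof.
rewrite coefME; case: n => [|m]; first by rewrite big_ord1 mkpsE mul0r.
rewrite !big_ord_recl !mkpsE /= mul0r add0r mul1r subSS subn0.
by rewrite big1 ?addr0 // => i _; rewrite mkpsE mul0r.
Qed.

Lemma coef_psXnM f m n :
  (psX ^+ m * f) n = if (n < m)%N then 0 else f (n - m)%N.
Proof.
elim: m n => [|m IH] n; first by rewrite mul1r subn0.
by rewrite exprS -mulrA coef_psXM; case: n => // n; rewrite IH.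
Qed.

Lemma coef_psXn m n : (psX ^+ m) n = (n == m)%:R.
Proof.
rewrite -[psX ^+ m]mulr1 coef_psXnM coef1E subn_eq0.
by case: ltngtP.
Qed.

(** * Truncation modulo powers of q and formal convergence *)

Definition eqmod N f g := forall n, (n < N)%N -> f n = g n.

Definition low_order N f := eqmod N f 0.

Lemma eqmod_sym N f g : eqmod N f g -> eqmod N g f.
Proof. by move=> fg n nN; rewrite fg. Qed.

Lemma eqmod_trans N g f h : eqmod N f g -> eqmod N g h -> eqmod N f h.
Proof. by move=> fg gh n nN; rewrite fg ?gh. Qed.

Lemma eqmod_le N M f g : (N <= M)%N -> eqmod M f g -> eqmod N f g.
Proof. by move=> NM fg n nN; apply: fg; apply: leq_trans NM. Qed.

Lemma eqmodD N f f' g g' :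
  eqmod N f f' -> eqmod N g g' -> eqmod N (f + g) (f' + g').
Proof. by move=> ff gg n nN; rewrite !coefDE ff ?gg. Qed.

Lemma eqmodN N f f' : eqmod N f f' -> eqmod N (- f) (- f').
Proof. by move=> ff n nN; rewrite !coefNE ff. Qed.

Lemma eqmodM N f f' g g' :
  eqmod N f f' -> eqmod N g g' -> eqmod N (f * g) (f' * g').
Proof.
move=> ff gg n nN; rewrite !coefME; apply: eq_bigr => i _.
by have := ltn_ord i => iN; rewrite ff ?gg //; lia.
Qed.

Lemma eqmod_subr N f g : low_order N (f - g) -> eqmod N f g.
Proof. by move=> fg n /fg /eqP; rewrite !coefE subr_eq0 => /eqP. Qed.

Lemma low_orderM N M f g :
  low_order N f -> low_order M g -> low_order (N + M) (f * g).
Proof.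
move=> fN gM n nNM; rewrite coef0E coefME big1 // => i _.
have [iN|Ni] := ltnP i N; first by rewrite fN ?coef0E ?mul0r.
by rewrite gM ?coef0E ?mulr0 //; have := ltn_ord i; lia.
Qed.

Lemma low_orderMl N f g : low_order N g -> low_order N (f * g).
Proof. by move=> gN; apply: (@low_orderM 0). Qed.

Lemma low_orderD N f g : low_order N f -> low_order N g -> low_order N (f + g).
Proof. by move=> f0 g0; rewrite /low_order -[0]addr0; apply: eqmodD. Qed.

Lemma low_orderX m f : low_order 1 f -> low_order m (f ^+ m).
Proof.
move=> f1; elim: m => [|m IH] //.
by rewrite exprS; apply: (@low_orderM 1 m).
Qed.

Lemma low_order1 f : f 0%N = 0 -> low_order 1 f.
Proof. by move=> f0 [|]//; rewrite f0 coef0E. Qed.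

(** Convergence in the q-adic topology. Identities between infinite sums and products are proved
    below by giving one sequence two limits. *)
Definition ps_cvg (u : nat -> pseries) f :=
  forall N, exists M, forall k, (M <= k)%N -> eqmod N (u k) f.

Lemma ps_cvg_unique u f g : ps_cvg u f -> ps_cvg u g -> f = g.
Proof.
move=> uf ug; apply: pseriesP => n.
have [[M uM] [M' uM']] := (uf n.+1, ug n.+1).
rewrite -(uM (maxn M M')) ?leq_maxl //.
by rewrite -(uM' (maxn M M')) ?leq_maxr.
Qed.

Lemma ps_cvg_cst f : ps_cvg (fun=> f) f.
Proof. by move=> N; exists 0%N. Qed.

Lemma ps_cvgD u v f g :
  ps_cvg u f -> ps_cvg v g -> ps_cvg (fun k => u k + v k) (f + g).
Proof.
move=> uf vg N; have [[M uM] [M' vM]] := (uf N, vg N).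
exists (maxn M M') => k; rewrite geq_max => /andP[/uM ? /vM ?].
exact: eqmodD.
Qed.

Lemma ps_cvgN u f : ps_cvg u f -> ps_cvg (fun k => - u k) (- f).
Proof.
by move=> uf N; have [M uM] := uf N; exists M => k /uM; apply: eqmodN.
Qed.

Lemma ps_cvgM u v f g :
  ps_cvg u f -> ps_cvg v g -> ps_cvg (fun k => u k * v k) (f * g).
Proof.
move=> uf vg N; have [[M uM] [M' vM]] := (uf N, vg N).
exists (maxn M M') => k; rewrite geq_max => /andP[/uM ? /vM ?].
exact: eqmodM.
Qed.

Lemma ps_cvgX m u f : ps_cvg u f -> ps_cvg (fun k => u k ^+ m) (f ^+ m).
Proof.
move=> uf; elim: m => [|m IH]; first exact: ps_cvg_cst.
have := ps_cvgM uf IH; congr ps_cvg; last by rewrite exprS.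
by apply/funext => k; rewrite exprS.
Qed.

Lemma ps_cvg_ext u v f : (forall k, u k = v k) -> ps_cvg u f -> ps_cvg v f.
Proof. by move=> uv; congr ps_cvg; apply/funext. Qed.

Lemma ps_cvg_sub (phi : nat -> nat) u f : (forall k, (k <= phi k)%N) ->
  ps_cvg u f -> ps_cvg (u \o phi) f.
Proof.
move=> kphi uf N; have [M uM] := uf N.
by exists M => k Mk; apply: uM; apply: leq_trans (kphi k).
Qed.

(** The index [n.+1] suits sequences whose k-th increment has order at least k: their n-th
    coefficient is constant from there on. *)
Definition ps_lim (u : nat -> pseries) := mkps (fun n => u n.+1 n).

Lemma ps_lim_eqmod u : (forall k, low_order k (u k.+1 - u k)) ->
  forall N k, (N <= k)%N -> eqmod N (u k) (ps_lim u).
Proof.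
move=> du.
have st n k : (n < k)%N -> u k n = u n.+1 n.
  elim: k => // k IH; rewrite ltnS leq_eqVlt => /orP[/eqP -> //|nk].
  by rewrite -IH //; apply: (eqmod_subr (du k)).
by move=> N k Nk n nN; rewrite mkpsE st //; apply: leq_trans Nk.
Qed.

Lemma ps_lim_cvg u : (forall k, low_order k (u k.+1 - u k)) ->
  ps_cvg u (ps_lim u).
Proof. by move=> du N; exists N => k; apply: ps_lim_eqmod. Qed.

(** The inverse is the geometric series in h = 1 - f, whose partial sums u satisfy 1 - f u_k =
    h^k. *)
Lemma ps_invP f : f 0%N = 1 -> exists g, f * g = 1.
Proof.
move=> f0; pose h := 1 - f; pose u n := \sum_(i < n) h ^+ i.
have h1 : low_order 1 h by apply: low_order1; rewrite !coefE f0 subrr.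
have du k : low_order k (u k.+1 - u k).
  by rewrite /u big_ord_recr addrC addKr; apply: low_orderX.
exists (ps_lim u); apply: (@ps_cvg_unique (fun k => f * u k)).
  exact: ps_cvgM (ps_cvg_cst f) (ps_lim_cvg du).
move=> N; exists N => k Nk; apply: eqmod_sym; apply: eqmod_subr.
have -> : 1 - f * u k = h ^+ k.
  by rewrite -[f](subKr 1) -/h -opprB mulNr /u -subrX1 opprK addrC subrK.
by move=> n nN; apply: (low_orderX h1); apply: leq_trans Nk.
Qed.

Lemma ps_mulI f g h : f 0%N = 1 -> f * g = f * h -> g = h.
Proof.
case/ps_invP=> f' ff' fgh.
by rewrite -[g]mul1r -[h]mul1r -ff' [f * f']mulrC -!mulrA fgh.
Qed.

Lemma coef0M f g : (f * g) 0%N = f 0%N * g 0%N.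
Proof. by rewrite coefME big_ord1. Qed.

Lemma coef0X f m : (f ^+ m) 0%N = f 0%N ^+ m.
Proof. by elim: m => [|m IH]; rewrite ?coef1E // !exprS coef0M IH. Qed.

End PowerSeries.

(** * Substitutions and dissections *)

Lemma big_blocks (S : Type) (idx : S) (op : Monoid.law idx) m N (F : nat -> S) :
  \big[op/idx]_(i < m * N) F i
    = \big[op/idx]_(k < N) \big[op/idx]_(r < m) F (m * k + r).
Proof.
elim: N => [|N IH]; first by rewrite muln0 !big_ord0.
by rewrite mulnS addnC big_split_ord big_ord_recr /= IH.
Qed.

Section Slices.
Local Open Scope ring_scope.
Variable R : comNzRingType.
Implicit Types (a f g : pseries R).
Local Notation q := (psX R).

(* For m > 0, [dilate m] is the substitution q := q^m. *)
Definition dilate m f :=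
  mkps (fun n => if (m %| n)%N then f (n %/ m)%N else 0).

Definition slice m r f := mkps (fun n => f (m * n + r)%N).

Lemma sliceE m r f n : slice m r f n = f (m * n + r)%N.
Proof. exact: mkpsE. Qed.

Lemma dilateE m f n :
  dilate m f n = if (m %| n)%N then f (n %/ m)%N else 0.
Proof. exact: mkpsE. Qed.

Lemma slice_zmod m r : zmod_morphism (slice m r).
Proof. by move=> f g; apply: pseriesP => n; rewrite !(sliceE, coefE). Qed.
HB.instance Definition _ m r :=
  GRing.isZmodMorphism.Build _ _ (slice m r) (slice_zmod m r).

Lemma dilate_zmod m : zmod_morphism (dilate m).
Proof.
move=> f g; apply: pseriesP => n; rewrite !(dilateE, coefE).
by case: ifP; rewrite ?subr0.
Qed.
HB.instance Definition _ m :=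
  GRing.isZmodMorphism.Build _ _ (dilate m) (dilate_zmod m).

(** Multiplication by a series in q^m preserves residues of exponents modulo m, so taking a slice is
    linear over such series. This drives every dissection below. *)
Lemma slice_dilateM m r a f : (r < m)%N ->
  slice m r (dilate m a * f) = a * slice m r f.
Proof.
move=> rm; have m0 : (0 < m)%N by apply: leq_ltn_trans rm.
apply: pseriesP => n; rewrite sliceE !coefME.
(* Padding with zeros up to m(n+1) terms cuts the sum into blocks of length m, in each of which only
   the first index is a multiple of m. *)
pose F i := if (i < (m * n + r).+1)%N then dilate m a i * f (m * n + r - i)%N else 0.
have -> : \sum_(i < (m * n + r).+1) dilate m a i * f (m * n + r - i)%N
   = \sum_(i < m * n.+1) F i.
  rewrite (big_ord_widen (m * n.+1) (fun i => dilate m a i * f (m * n + r - i)%N)).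
    by rewrite big_mkcond; apply: eq_bigr.
  by nia.
rewrite big_blocks; apply: eq_bigr => k _; have := ltn_ord k => kn.
rewrite (bigD1 (Ordinal m0)) //= big1 ?addr0; last first.
  move=> i i0; rewrite /F dilateE dvdn_addr ?dvdn_mulr //.
  rewrite gtnNdvd ?mul0r ?if_same //.
  by rewrite lt0n; apply: contra_neq i0 => i0; apply: val_inj.
rewrite addn0 /F dilateE dvdn_mulr // mulKn // ifT; last by nia.
by rewrite sliceE; congr (_ * f _); nia.
Qed.

Lemma pseries_slices m f g : (0 < m)%N ->
  (forall r, (r < m)%N -> slice m r f = slice m r g) -> f = g.
Proof.
move=> m0 fg; apply: pseriesP => n.
rewrite (divn_eq n m) mulnC.
by have /(congr1 (fun h => coefs h (n %/ m))) := fg _ (ltn_pmod n m0);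
  rewrite !sliceE.
Qed.

Lemma slice_dilate m r a : (r < m)%N ->
  slice m r (dilate m a) = if r == 0%N then a else 0.
Proof.
move=> rm; apply: pseriesP => n; rewrite sliceE dilateE.
rewrite dvdn_addr ?dvdn_mulr //; case: eqP => [->|r0].
  by rewrite dvdn0 addn0 mulKn //; apply: leq_ltn_trans rm.
by rewrite coef0E gtnNdvd //; lia.
Qed.

(** For m > 0 both sides have the same slices modulo m. For m = 0 the convention n %/ 0 = 0 makes
    [dilate 0] the constant-term map, again multiplicative, so the morphism instance covers every
    m. *)
Lemma dilate_monoid m : monoid_morphism (dilate m).
Proof.
split=> [|f g].
  apply: pseriesP => n; rewrite dilateE !coef1E; case: m => [|m].
    by rewrite dvd0n; case: eqP => // ->.
  case: n => [|n]; first by rewrite dvdn0 div0n.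
  case: ifP => // mn; suff /negPf -> : (n.+1 %/ m.+1 != 0)%N by [].
  by rewrite -lt0n divn_gt0 // dvdn_leq.
case: m => [|m].
  apply: pseriesP => n; rewrite dilateE dvd0n; case: eqP => [->|/eqP n0].
    by rewrite !coef0M !dilateE dvdn0 div0n.
  rewrite coefME big1 // => i _; rewrite !dilateE !dvd0n subn_eq0.
  case: eqP => i0; last by rewrite mul0r.
  by rewrite i0 leqn0 (negPf n0) mulr0.
apply: (@pseries_slices m.+1) => // r rm.
rewrite slice_dilateM // !slice_dilate //.
by case: eqP => // _; rewrite mulr0.
Qed.
HB.instance Definition _ m :=
  GRing.isMonoidMorphism.Build _ _ (dilate m) (dilate_monoid m).

Lemma dilateX m : (0 < m)%N -> dilate m q = q ^+ m.
Proof.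
move=> m0; apply: pseriesP => n; rewrite dilateE coef_psXn.
case: ifP => [/dvdnP[k ->]|]; last by case: eqP => // ->; rewrite dvdnn.
by rewrite mulnK //= coef_psX -{2}(mul1n m) eqn_pmul2r.
Qed.

Lemma dilate_comp m n f : dilate m (dilate n f) = dilate (m * n) f.
Proof.
apply: pseriesP => k; rewrite !dilateE.
have [mk|mk] := boolP (m %| k)%N; last first.
  by case: ifP => // /(dvdn_trans (dvdn_mulr n (dvdnn m))); rewrite (negPf mk).
case: m mk => [|m mk]; last by rewrite dvdn_divRL // divnMA mulnC.
rewrite dvd0n => /eqP ->; rewrite !dvdn0 !div0n //.
Qed.

Lemma slice_X m r s : (r < m)%N -> (s < m)%N ->
  slice m r (q ^+ s) = (r == s)%:R.
Proof.
move=> rm sm; apply: pseriesP => n; rewrite sliceE coef_psXn.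
have -> : (m * n + r == s)%N = (n == 0)%N && (r == s).
  by case: n => [|n]; [rewrite muln0 | apply/negbTE/eqP; nia].
by case: (r == s); rewrite ?andbT ?andbF ?coefE.
Qed.

Lemma slice_dilateMX m r s a : (r < m)%N -> (s < m)%N ->
  slice m r (dilate m a * q ^+ s) = if r == s then a else 0.
Proof.
move=> rm sm; rewrite slice_dilateM // slice_X //.
by case: eqP; rewrite ?mulr1 ?mulr0.
Qed.

Lemma dissect3 f :
  f = dilate 3 (slice 3 0 f) + dilate 3 (slice 3 1 f) * q
      + dilate 3 (slice 3 2 f) * q ^+ 2.
Proof.
apply: (@pseries_slices 3) => // r r3; rewrite -{1}(expr1 q) !raddfD /=.
by rewrite !slice_dilateMX // slice_dilate //; case: r r3 => [|[|[|]]] //= _;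
  rewrite ?addr0 ?add0r.
Qed.

Lemma slice3E a b c f : f = dilate 3 a + dilate 3 b * q + dilate 3 c * q ^+ 2 ->
  [/\ slice 3 0 f = a, slice 3 1 f = b & slice 3 2 f = c].
Proof.
by move->; rewrite -(expr1 q) -exprM !raddfD /= !slice_dilateMX // !slice_dilate //=;
  rewrite !addr0 ?add0r.
Qed.

(* The norm of f, viewed as an element of the cubic extension of the series in
   q^3 generated by q: the product of the f(w q) over the cubic roots of unity
   w, written as a series in q^3. *)
Definition norm3 f :=
  let a := slice 3 0 f in let b := slice 3 1 f in let c := slice 3 2 f in
  a ^+ 3 + q * b ^+ 3 + q ^+ 2 * c ^+ 3 - 3%:R * q * a * b * c.

Lemma norm3E f a b c : f = dilate 3 a + dilate 3 b * q + dilate 3 c * q ^+ 2 ->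
  norm3 f = a ^+ 3 + q * b ^+ 3 + q ^+ 2 * c ^+ 3 - 3%:R * q * a * b * c.
Proof. by move=> /slice3E[]; rewrite /norm3 => -> -> ->. Qed.

Lemma norm3M f g : norm3 (f * g) = norm3 f * norm3 g.
Proof.
have [a [b [c fE]]] : exists a b c,
    f = dilate 3 a + dilate 3 b * q + dilate 3 c * q ^+ 2.
  by do 3!eexists; apply: dissect3.
have [a' [b' [c' gE]]] : exists a b c,
    g = dilate 3 a + dilate 3 b * q + dilate 3 c * q ^+ 2.
  by do 3!eexists; apply: dissect3.
rewrite (norm3E fE) (norm3E gE).
(* Components of the product on 1, q, q^2: terms in q^3 and q^4 are carried back, with q^3 written q
   inside the components. *)
rewrite (@norm3E (f * g) (a * a' + q * (b * c' + c * b'))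
  (a * b' + b * a' + q * (c * c')) (a * c' + b * b' + c * a')); first by ring.
by rewrite fE gE !(rmorphD, rmorphM) /= !dilateX //; ring.
Qed.

Lemma norm31 : norm3 1 = 1.
Proof. by rewrite (@norm3E _ 1 0 0) ?rmorph1 ?rmorph0; ring. Qed.

Lemma norm3_dilate f : norm3 (dilate 3 f) = f ^+ 3.
Proof. by rewrite (@norm3E _ f 0 0) ?rmorph0; ring. Qed.

(** As n is prime to 3, w^n runs over all cubic roots of unity with w, and the product of the 1 -
    w^n q^n is 1 - q^(3n), a series in q^3. *)
Lemma norm3_1subX n : ~~ (3 %| n)%N -> norm3 (1 - q ^+ n) = 1 - q ^+ n.
Proof.
move=> n3; have := divn_eq n 3; have := ltn_pmod n (isT : (0 < 3)%N).
move: n3; rewrite /dvdn; move: (n %% 3)%N (n %/ 3)%N => [|[|[|]]] // k _ _ ->.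
  rewrite (@norm3E _ 1 (- q ^+ k) 0).
    by rewrite exprD exprM; ring.
  by rewrite rmorph1 rmorphN rmorphXn rmorph0 /= dilateX // exprD mulnC exprM; ring.
rewrite (@norm3E _ 1 0 (- q ^+ k)).
  by rewrite exprD exprM; ring.
by rewrite rmorph1 rmorphN rmorphXn rmorph0 /= dilateX // exprD mulnC exprM; ring.
Qed.

(** Doubling exponents exchanges the residues 1 and 2 modulo 3; the extra q comes from 2(3k+2) =
    3(2k+1) + 1. *)
Lemma dilate2_dissect3 f : dilate 2 f = dilate 3 (dilate 2 (slice 3 0 f))
  + dilate 3 (dilate 2 (slice 3 2 f) * q) * q
  + dilate 3 (dilate 2 (slice 3 1 f)) * q ^+ 2.
Proof.
rewrite {1}(dissect3 f) !(rmorphD, rmorphM, rmorphXn) /= !dilateX // !dilate_comp.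
by ring.
Qed.

Lemma norm3_dilate2 f : norm3 (dilate 2 f) = dilate 2 (norm3 f).
Proof.
rewrite (norm3E (dilate2_dissect3 f)).
rewrite /norm3 !(rmorphB, rmorphD, rmorphM, rmorphXn, rmorph_nat) /= !dilateX //.
by ring.
Qed.

Lemma slice_eqmod m r N f g : (r < m)%N ->
  eqmod (m * N) f g -> eqmod N (slice m r f) (slice m r g).
Proof. by move=> rm fg n nN; rewrite !sliceE fg //; nia. Qed.

Lemma ps_cvg_slice m r u f : (r < m)%N ->
  ps_cvg u f -> ps_cvg (fun k => slice m r (u k)) (slice m r f).
Proof.
move=> rm uf N; have [M uM] := uf (m * N)%N.
by exists M => k /uM; apply: slice_eqmod.
Qed.

Lemma ps_cvg_dilate m u f : (0 < m)%N ->
  ps_cvg u f -> ps_cvg (fun k => dilate m (u k)) (dilate m f).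
Proof.
move=> m0 uf N; have [M uM] := uf N; exists M => k /uM ukf n nN.
by rewrite !dilateE; case: ifP => // _; rewrite ukf // (leq_ltn_trans _ nN) ?leq_div.
Qed.

Lemma ps_cvg_norm3 u f : ps_cvg u f -> ps_cvg (fun k => norm3 (u k)) (norm3 f).
Proof.
move=> uf; have cX r : (r < 3)%N -> _ := fun r3 => ps_cvg_slice r3 uf.
apply: ps_cvgD; last first.
  by apply: ps_cvgN; do !apply: ps_cvgM; try apply: ps_cvg_cst; apply: cX.
apply: ps_cvgD; first apply: ps_cvgD.
- by apply: ps_cvgX; apply: cX.
- by apply: ps_cvgM (ps_cvg_cst _) _; apply: ps_cvgX; apply: cX.
- by apply: ps_cvgM (ps_cvg_cst _) _; apply: ps_cvgX; apply: cX.
Qed.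

(** * The substitution of -q for q *)

Definition negX f := mkps (fun n => (-1) ^+ n * f n).

Lemma negXE f n : negX f n = (-1) ^+ n * f n.
Proof. exact: mkpsE. Qed.

Lemma negX_zmod : zmod_morphism negX.
Proof. by move=> f g; apply: pseriesP => n; rewrite !(coefE, negXE) mulrBr. Qed.
HB.instance Definition _ := GRing.isZmodMorphism.Build _ _ negX negX_zmod.

Lemma negX_monoid : monoid_morphism negX.
Proof.
split=> [|f g]; apply: pseriesP => n.
  by rewrite negXE coef1E; case: n => [|n]; rewrite ?mul1r // mulr0.
rewrite negXE !coefME mulr_sumr; apply: eq_bigr => i _.
have -> : (-1) ^+ n = (-1) ^+ i * (-1) ^+ (n - i) :> R.
  by rewrite -exprD subnKC // -ltnS.
by rewrite !negXE mulrACA.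
Qed.
HB.instance Definition _ := GRing.isMonoidMorphism.Build _ _ negX negX_monoid.

Lemma negX_X : negX q = - q.
Proof.
by apply: pseriesP => -[|[|n]];
  rewrite coefNE negXE !coef_psX /= ?mulr0 ?oppr0 // mulr1.
Qed.

Lemma negX_dilate_even m f : ~~ odd m -> negX (dilate m f) = dilate m f.
Proof.
move=> om; apply: pseriesP => n; rewrite negXE dilateE.
case: ifP => [mn|]; last by rewrite mulr0.
by rewrite -{1}(divnK mn) mulnC exprM -signr_odd (negPf om) expr1n mul1r.
Qed.

Lemma slice_negX_odd m r f : odd m -> odd r ->
  slice m r (negX f) = - negX (slice m r f).
Proof.
move=> om or; apply: pseriesP => n; rewrite coefNE !(negXE, sliceE).
by rewrite exprD exprM -(signr_odd _ m) om -(signr_odd _ r) or mulrN1 mulNr.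
Qed.

Lemma ps_cvg_negX u f : ps_cvg u f -> ps_cvg (fun k => negX (u k)) (negX f).
Proof.
move=> uf N; have [M uM] := uf N; exists M => k /uM ukf n nN.
by rewrite !negXE ukf.
Qed.

End Slices.

(** * The finite triple product *)

Section FiniteTripleProduct.
Local Open Scope ring_scope.
Variable A : comNzRingType.
Implicit Types a b Q : A.

(** The q-Pochhammer symbol (-a; Q)_n, with the sign that suits the triple product. *)
Definition qpoch a Q n := \prod_(k < n) (1 + a * Q ^+ k).

Lemma qpochS a Q n : qpoch a Q n.+1 = qpoch a Q n * (1 + a * Q ^+ n).
Proof. by rewrite /qpoch big_ord_recr. Qed.

Lemma qpoch_blocks a Q m n :
  qpoch a Q (m * n) = \prod_(r < m) qpoch (a * Q ^+ r) (Q ^+ m) n.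
Proof.
rewrite /qpoch (big_blocks _ _ _ (fun k => 1 + a * Q ^+ k)) exchange_big.
apply: eq_bigr => r _; apply: eq_bigr => k _.
by rewrite addnC exprD exprM mulrA.
Qed.

(** Gaussian binomial coefficients, defined by a q-Pascal rule so that no division is required in
    the ring. *)
Fixpoint gauss_bin Q n k :=
  match n, k with
  | _, 0 => 1
  | 0, _.+1 => 0
  | n'.+1, k'.+1 => gauss_bin Q n' k' + Q ^+ k * gauss_bin Q n' k
  end.

Lemma gauss_bin0 Q n : gauss_bin Q n 0 = 1. Proof. by case: n. Qed.

Lemma gauss_binS Q n k :
  gauss_bin Q n.+1 k.+1 = gauss_bin Q n k + Q ^+ k.+1 * gauss_bin Q n k.+1.
Proof. by []. Qed.

Lemma gauss_bin_small Q n k : (n < k)%N -> gauss_bin Q n k = 0.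
Proof.
elim: n k => [|n IH] [|k] //= nk.
by rewrite !IH ?mulr0 ?addr0 //; apply: ltnW.
Qed.

(** The other q-Pascal rule. In the finite triple product it accounts for a new factor in a, the
    defining rule for a new factor in b. *)
Lemma gauss_binSr Q n k : (k <= n)%N ->
  gauss_bin Q n.+1 k.+1 = Q ^+ (n - k) * gauss_bin Q n k + gauss_bin Q n k.+1.
Proof.
elim: n k => [|n IH] k kn.
  by move: kn; rewrite leqn0 => /eqP -> /=; rewrite mulr0 mul1r.
rewrite gauss_binS; case: k kn => [|k] kn.
  rewrite !gauss_bin0 !subn0 gauss_binS.
  have := IH 0%N isT; rewrite gauss_binS !gauss_bin0 subn0 !mulr1 => E.
  by rewrite [in LHS]E [Q ^+ n.+1]exprS; ring.
move: (kn); rewrite ltnS leq_eqVlt => /orP[/eqP ->|kn'].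
  by rewrite subnn !(gauss_bin_small _ (ltnSn _)) mulr0 mul1r.
rewrite ![in RHS]gauss_binS (IH k) 1?ltnW // (IH k.+1) //.
rewrite subSS !mulrDr !mulrA -!exprD.
have -> : (k.+2 + (n - k.+1))%N = n.+1 by lia.
have -> : (n - k + k.+1)%N = n.+1 by lia.
by ring.
Qed.

(** The quotient formula for Gaussian binomials, cleared of denominators. *)
Lemma gauss_bin_qpoch Q n k : (k <= n)%N ->
  gauss_bin Q n k * qpoch (- Q) Q k * qpoch (- Q) Q (n - k) = qpoch (- Q) Q n.
Proof.
elim: n k => [|n IH] [|k] kn //; rewrite ?gauss_bin0.
- by rewrite /qpoch big_ord0 !mulr1.
- by rewrite subn0 {1}/qpoch big_ord0 !mul1r.
rewrite subSS gauss_binS.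
move: kn; rewrite ltnS leq_eqVlt => /orP[/eqP ->|kn].
  have := IH _ (leqnn n); rewrite subnn [qpoch _ _ 0]big_ord0 !mulr1 => E.
  rewrite (gauss_bin_small _ (ltnSn n)) mulr0 addr0.
  by rewrite qpochS mulrA E.
have E1 := IH _ (ltnW kn); have E2 := IH _ kn.
have nk : (n - k)%N = (n - k.+1).+1 by lia.
rewrite nk !qpochS in E1 E2 *.
(* This is 1 - Q^(n+1) = (1 - Q^(k+1)) + Q^(k+1) (1 - Q^(n-k)), matching the two terms of the
   q-Pascal rule. *)
have -> : qpoch (- Q) Q n * (1 + - Q * Q ^+ n)
   = qpoch (- Q) Q n * (1 + - Q * Q ^+ k)
     + Q ^+ k.+1 * qpoch (- Q) Q n * (1 + - Q * Q ^+ (n - k.+1)).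
  have -> : Q ^+ n = Q ^+ k * Q * Q ^+ (n - k.+1).
    by rewrite -exprSr -exprD; congr (_ ^+ _); lia.
  by rewrite exprSr; ring.
rewrite -{1}E1 -E2.
by ring.
Qed.

(** This is a^(j(j+1)/2) b^(j(j-1)/2) for the integer j = r - n. Subtraction being truncated, one of
    the two halves is always 1. *)
Definition theta_term a b n r :=
  a ^+ 'C((r - n).+1, 2) * b ^+ 'C(r - n, 2)
  * (a ^+ 'C(n - r, 2) * b ^+ 'C((n - r).+1, 2)).

Lemma theta_termSS a b n r : theta_term a b n.+1 r.+1 = theta_term a b n r.
Proof. by rewrite /theta_term !subSS. Qed.

Lemma binS2 k : 'C(k.+1, 2) = ('C(k, 2) + k)%N.
Proof. by rewrite binS bin1. Qed.

(** Consecutive terms have ratio a (ab)^j with j = r - n; the powers of ab on both sides avoid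
    negative exponents. *)
Lemma theta_term_left a b m n r : (r <= m + n)%N ->
  a * (a * b) ^+ m * theta_term a b n r
    = (a * b) ^+ (m + n - r) * theta_term a b n r.+1.
Proof.
move=> rmn; rewrite /theta_term; have [nr|rn] := leqP n r.
  have -> : (n - r = 0)%N by lia.
  have -> : (n - r.+1 = 0)%N by lia.
  rewrite subSn // -{1}(@subnK (r - n) m); last by lia.
  have -> : (m + n - r = m - (r - n))%N by lia.
  by rewrite !(binS2 (r - n).+1) !binS2 exprD !exprMn !exprD !exprS; ring.
have -> : (r - n = 0)%N by lia.
have -> : (r.+1 - n = 0)%N by lia.
have -> : (n - r = (n - r.+1).+1)%N by lia.
have -> : (m + n - r = m + (n - r.+1).+1)%N by lia.
by rewrite !(binS2 (n - r.+1).+1) !binS2 !exprMn !exprD !exprS; ring.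
Qed.

Lemma theta_term_right a b n r :
  b * (a * b) ^+ n * theta_term a b n r
    = (a * b) ^+ r * theta_term a b n.+1 r.
Proof.
rewrite /theta_term; have [nr|rn] := ltnP n r.
  have -> : (n - r = 0)%N by lia.
  have -> : (n.+1 - r = 0)%N by lia.
  have -> : (r - n = (r - n.+1).+1)%N by lia.
  have -> : (a * b) ^+ r = (a * b) ^+ (n + (r - n.+1).+1).
    by congr (_ ^+ _); lia.
  by rewrite !(binS2 (r - n.+1).+1) !binS2 !exprMn !exprD !exprS; ring.
have -> : (r - n = 0)%N by lia.
have -> : (r - n.+1 = 0)%N by lia.
rewrite subSn //.
have -> : (a * b) ^+ n = (a * b) ^+ (r + (n - r)) by rewrite subnKC.
by rewrite !(binS2 (n - r).+1) !binS2 !exprMn !exprD !exprS; ring.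
Qed.

(** Induction on n for m = 0, then on m. A new factor splits the left side into two sums, a q-Pascal
    rule splits the right side, and the ratio of consecutive terms matches them. *)
Lemma finite_triple_product a b m n :
  qpoch a (a * b) m * qpoch b (a * b) n
    = \sum_(r < (m + n).+1) gauss_bin (a * b) (m + n) r * theta_term a b n r.
Proof.
set Q := a * b; elim: m => [|m IHm].
  rewrite {1}/qpoch big_ord0 mul1r add0n; elim: n => [|n IHn].
    by rewrite /qpoch big_ord0 big_ord1 /theta_term /= !mulr1.
  rewrite qpochS IHn mulrDr mulr1 mulr_suml [RHS]big_ord_recl.
  under [X in _ = _ + X]eq_bigr => r _ do
    rewrite lift0 theta_termSS gauss_binS mulrDl.
  rewrite big_split /= addrCA; congr (_ + _).
  rewrite big_ord_recl [X in _ = _ + X]big_ord_recr /= gauss_bin0.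
  rewrite (gauss_bin_small _ (ltnSn n)) mulr0 mul0r addr0; congr (_ + _).
    by rewrite mul1r mulrC theta_term_right.
  apply: eq_bigr => r _; rewrite /bump /= add1n -(theta_termSS _ _ n r).
  by rewrite [RHS]mulrAC -theta_term_right -/Q; ring.
rewrite qpochS mulrAC IHm mulrDr mulr1 mulr_suml addSn [RHS]big_ord_recl.
under [X in _ = _ + X]eq_bigr => r _.
  rewrite lift0 gauss_binSr -1?ltnS // mulrDl; over.
rewrite big_split /= [LHS]addrC [RHS]addrCA; congr (_ + _).
  apply: eq_bigr => r _; rewrite [RHS]mulrAC -theta_term_left -1?ltnS //.
  by rewrite -/Q; ring.
rewrite big_ord_recl gauss_bin0 [X in _ = _ + X]big_ord_recr /=.
by rewrite (gauss_bin_small _ (ltnSn _)) mul0r addr0.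
Qed.

End FiniteTripleProduct.

(** * The Jacobi triple product *)

Section JacobiTripleProduct.
Local Open Scope ring_scope.
Variable R : comNzRingType.
Implicit Types (a b Q f : pseries R).

Lemma ps_cvg_prod (I : Type) (r : seq I) (u : I -> nat -> pseries R)
  (f : I -> pseries R) :
  (forall i, ps_cvg (u i) (f i)) ->
  ps_cvg (fun n => \prod_(i <- r) u i n) (\prod_(i <- r) f i).
Proof.
move=> uf; elim: r => [|i r IH].
  rewrite big_nil; apply: ps_cvg_ext (ps_cvg_cst 1) => n.
  by rewrite big_nil.
rewrite big_cons; apply: ps_cvg_ext (ps_cvgM (uf i) IH) => n.
by rewrite big_cons.
Qed.

Lemma eqmod_sum (I : finType) N (F G : I -> pseries R) :
  (forall i, eqmod N (F i) (G i)) -> eqmod N (\sum_i F i) (\sum_i G i).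
Proof.
by move=> FG n nN; rewrite !coef_sumE; apply: eq_bigr => i _; apply: FG.
Qed.

Definition qpinf a Q := ps_lim (qpoch a Q).

Lemma qpoch_step a Q n : a 0%N = 0 -> Q 0%N = 0 ->
  low_order n (qpoch a Q n.+1 - qpoch a Q n).
Proof.
move=> a0 Q0; rewrite qpochS mulrDr mulr1 addrC addKr.
by do 2!apply: low_orderMl; apply: low_orderX; apply: low_order1.
Qed.

Lemma qpinf_eqmod a Q N n : a 0%N = 0 -> Q 0%N = 0 -> (N <= n)%N ->
  eqmod N (qpoch a Q n) (qpinf a Q).
Proof. by move=> a0 Q0; apply: ps_lim_eqmod => k; apply: qpoch_step. Qed.

Lemma qpinf_cvg a Q : a 0%N = 0 -> Q 0%N = 0 ->
  ps_cvg (qpoch a Q) (qpinf a Q).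
Proof. by move=> a0 Q0; apply: ps_lim_cvg => k; apply: qpoch_step. Qed.

Lemma qpinf_coef0 a Q : a 0%N = 0 -> qpinf a Q 0%N = 1.
Proof.
move=> a0; rewrite /qpinf mkpsE /qpoch big_ord1 expr0 mulr1.
by rewrite coefDE a0 addr0 coef1E.
Qed.

Lemma qpinf_blocks m a Q : (0 < m)%N -> a 0%N = 0 -> Q 0%N = 0 ->
  qpinf a Q = \prod_(r < m) qpinf (a * Q ^+ r) (Q ^+ m).
Proof.
move=> m0 a0 Q0; apply: (@ps_cvg_unique _ (fun n => qpoch a Q (m * n))).
  by apply: (ps_cvg_sub _ (qpinf_cvg a0 Q0)) => n; apply: leq_pmull.
have -> : (fun n => qpoch a Q (m * n)) =
    fun n => \prod_(r < m) qpoch (a * Q ^+ r) (Q ^+ m) n.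
  by apply/funext => n; apply: qpoch_blocks.
apply: ps_cvg_prod => r; apply: qpinf_cvg; first by rewrite coef0M a0 mul0r.
by rewrite coef0X Q0 expr0n eqn0Ngt m0.
Qed.

Lemma qpinf_conj a Q : a 0%N = 0 -> Q 0%N = 0 ->
  qpinf a Q * qpinf (- a) Q = qpinf (- a ^+ 2) (Q ^+ 2).
Proof.
move=> a0 Q0; have na0 : (- a) 0%N = 0 by rewrite coefNE a0 oppr0.
apply: (ps_cvg_unique (ps_cvgM (qpinf_cvg a0 Q0) (qpinf_cvg na0 Q0))).
have -> : (fun k => qpoch a Q k * qpoch (- a) Q k) = qpoch (- a ^+ 2) (Q ^+ 2).
  apply/funext => n; rewrite /qpoch -big_split; apply: eq_bigr => k _ /=.
  by rewrite -exprM mulnC exprM; ring.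
by apply: qpinf_cvg; rewrite ?coefNE coef0X ?a0 ?Q0 expr0n ?oppr0.
Qed.

Lemma rmorph_qpoch (F : {rmorphism pseries R -> pseries R}) a Q n :
  F (qpoch a Q n) = qpoch (F a) (F Q) n.
Proof.
rewrite rmorph_prod; apply: eq_bigr => k _.
by rewrite rmorphD rmorph1 rmorphM rmorphXn.
Qed.

Lemma dilate_qpinf m a Q : (0 < m)%N -> a 0%N = 0 -> Q 0%N = 0 ->
  dilate m (qpinf a Q) = qpinf (dilate m a) (dilate m Q).
Proof.
move=> m0 a0 Q0; apply: (ps_cvg_unique (ps_cvg_dilate m0 (qpinf_cvg a0 Q0))).
have -> : (fun k => dilate m (qpoch a Q k)) = qpoch (dilate m a) (dilate m Q).
  by apply/funext => n; apply: rmorph_qpoch.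
by apply: qpinf_cvg; rewrite dilateE dvdn0 div0n.
Qed.

Lemma negX_qpinf a Q : a 0%N = 0 -> Q 0%N = 0 ->
  negX (qpinf a Q) = qpinf (negX a) (negX Q).
Proof.
move=> a0 Q0; apply: (ps_cvg_unique (ps_cvg_negX (qpinf_cvg a0 Q0))).
have -> : (fun k => negX (qpoch a Q k)) = qpoch (negX a) (negX Q).
  by apply/funext => n; apply: rmorph_qpoch.
by apply: qpinf_cvg; rewrite negXE mul1r.
Qed.

(* Ramanujan's f(a,b), the sum of the a^(k(k+1)/2) b^(k(k-1)/2) over the
   integers k; the summand below groups the indices k+1 and -(k+1). *)
Definition theta_summand a b k :=
  a ^+ 'C(k.+2, 2) * b ^+ 'C(k.+1, 2) + a ^+ 'C(k.+1, 2) * b ^+ 'C(k.+2, 2).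

Definition theta_psum a b n := 1 + \sum_(k < n) theta_summand a b k.

Definition theta a b := ps_lim (theta_psum a b).

Lemma leq_binS2 k : (k <= 'C(k.+1, 2))%N.
Proof. by rewrite binS2 leq_addl. Qed.

Lemma low_order_expr N f m : f 0%N = 0 -> (N <= m)%N -> low_order N (f ^+ m).
Proof.
by move=> f0 Nm; apply: eqmod_le Nm (low_orderX (low_order1 f0)).
Qed.

Lemma theta_psum_step a b n : a 0%N = 0 -> b 0%N = 0 ->
  low_order n (theta_psum a b n.+1 - theta_psum a b n).
Proof.
move=> a0 b0; rewrite /theta_psum big_ord_recr opprD addrACA subrr add0r.
rewrite addrC addKr; apply: low_orderD.
  rewrite mulrC; apply: low_orderMl; apply: low_order_expr => //.
  exact: leq_trans (leqnSn n) (leq_binS2 _).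
apply: low_orderMl; apply: low_order_expr => //.
exact: leq_trans (leqnSn n) (leq_binS2 _).
Qed.

Lemma theta_cvg a b : a 0%N = 0 -> b 0%N = 0 ->
  ps_cvg (theta_psum a b) (theta a b).
Proof. by move=> a0 b0; apply: ps_lim_cvg => n; apply: theta_psum_step. Qed.

(** Both sides run over the integers j from -n to n; raising n shifts the index by one and adds the
    two end terms. *)
Lemma theta_psumE a b n :
  theta_psum a b n = \sum_(r < (n + n).+1) theta_term a b n r.
Proof.
elim: n => [|n IH].
  by rewrite /theta_psum big_ord0 big_ord1 /theta_term /= !mulr1 addr0.
rewrite /theta_psum big_ord_recr /= addrA -/(theta_psum a b n) IH.
rewrite addSn addnS [RHS]big_ord_recl [X in _ = _ + X]big_ord_recr /=.
under [X in _ = _ + (X + _)]eq_bigr => r _ do rewrite /bump /= add1n theta_termSS.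
rewrite [RHS]addrCA; congr (_ + _); rewrite /bump /= add1n theta_termSS addrC.
rewrite /theta_term !subn0 !sub0n !bin0n /= !mul1r; congr (_ + _).
have -> : ((n + n).+1 - n = n.+1)%N by lia.
have -> : (n - (n + n).+1 = 0)%N by lia.
by rewrite !mulr1.
Qed.

Lemma theta_term_low_order a b N n r : a 0%N = 0 -> b 0%N = 0 ->
  (N <= r - n)%N || (N <= n - r)%N -> low_order N (theta_term a b n r).
Proof.
move=> a0 b0 /orP[Nr|Nr]; rewrite /theta_term.
  rewrite -mulrA mulrC; apply: low_orderMl; apply: low_order_expr => //.
  exact: leq_trans Nr (leq_binS2 _).
rewrite mulrA; apply: low_orderMl; apply: low_order_expr => //.
exact: leq_trans Nr (leq_binS2 _).
Qed.

(** Since r, n - r and n are all at least N, the three symbols in [gauss_bin_qpoch] agree with E =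
    (Q; Q)_oo modulo q^N, and one factor E cancels. *)
Lemma gauss_bin_eqmod Q N n r : Q 0%N = 0 -> (N <= r)%N -> (r + N <= n)%N ->
  eqmod N (gauss_bin Q n r * qpinf (- Q) Q) 1.
Proof.
move=> Q0 Nr rn; have nQ0 : (- Q) 0%N = 0 by rewrite coefNE Q0 oppr0.
have cE k : (N <= k)%N -> eqmod N (qpoch (- Q) Q k) (qpinf (- Q) Q).
  exact: qpinf_eqmod.
set E := qpinf _ _ in cE *.
have [E' EE'] := ps_invP (qpinf_coef0 Q nQ0).
have gE : eqmod N (gauss_bin Q n r * E * E) E.
  apply: (@eqmod_trans _ _ (qpoch (- Q) Q n)); last by apply: cE; lia.
  rewrite -(@gauss_bin_qpoch _ Q n r) //; last by lia.
  apply: eqmodM; last by apply: eqmod_sym; apply: cE; lia.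
  by apply: eqmodM => //; apply: eqmod_sym; apply: cE.
have -> : gauss_bin Q n r * E = gauss_bin Q n r * E * E * E'.
  by rewrite -mulrA EE' mulr1.
by rewrite -EE'; apply: eqmodM.
Qed.

(** The finite product with m = n, multiplied by (Q; Q)_oo, is compared with the theta series modulo
    q^N: outer terms vanish on both sides, and central Gaussian binomials become 1. *)
Theorem jacobi_triple_product a b : a 0%N = 0 -> b 0%N = 0 ->
  theta a b = qpinf a (a * b) * qpinf b (a * b) * qpinf (- (a * b)) (a * b).
Proof.
move=> a0 b0; set Q := a * b.
have Q0 : Q 0%N = 0 by rewrite coef0M a0 mul0r.
have cab := ps_cvgM (qpinf_cvg a0 Q0) (qpinf_cvg b0 Q0).
apply: esym; apply: (ps_cvg_unique (ps_cvgM cab (ps_cvg_cst _))) => N.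
have [M cM] := theta_cvg a0 b0 N.
(* With n at least 2N, every r with |r - n| < N satisfies r >= N and r + N <= 2n. *)
exists (maxn M (N + N)) => n; rewrite geq_max => /andP[Mn Nn].
apply: eqmod_trans (cM _ Mn); rewrite theta_psumE finite_triple_product mulr_suml.
apply: eqmod_sum => r; rewrite -/Q mulrAC.
have [rN|/norP[]] := boolP ((N <= r - n)%N || (N <= n - r)%N).
  have tN := theta_term_low_order a0 b0 rN.
  by apply: eqmod_trans (eqmod_sym tN); apply: low_orderMl.
rewrite -!ltnNge => rn nr; rewrite -[X in eqmod _ _ X]mul1r.
by apply: eqmodM => //; apply: gauss_bin_eqmod => //; lia.
Qed.

End JacobiTripleProduct.

(** * Products for theta functions *)

(** The f_m of the opening comment, locked against unfolding during conversion. *)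
HB.lock Definition euler (R : comNzRingType) m : pseries R :=
  qpinf (- psX R ^+ m)%R (psX R ^+ m)%R.
Canonical euler_unlockable := Unlockable euler.unlock.

(* [ring] compares atoms up to conversion, which is slow on unfoldable ones. *)
Ltac qring := repeat match goal with
  | |- context [qpinf ?a ?b] => let x := fresh in set x := (qpinf a b); clearbody x
  | |- context [theta ?a ?b] => let x := fresh in set x := (theta a b); clearbody x
  | |- context [@euler ?R] => let x := fresh in set x := (@euler R); clearbody x
  end; ring.

Section ThetaFunctions.
Local Open Scope ring_scope.
Variable R : comNzRingType.
Local Notation q := (psX R).
Implicit Types (a Q : pseries R).

Lemma coef0_Xn m : (0 < m)%N -> (q ^+ m) 0%N = 0.
Proof. by rewrite coef_psXn eq_sym; case: m. Qed.

Lemma coef0_NXn m : (0 < m)%N -> (- q ^+ m) 0%N = 0.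
Proof. by move=> m0; rewrite coefNE coef0_Xn ?oppr0. Qed.

Lemma coef0_X : q 0%N = 0. Proof. by rewrite coef_psX. Qed.

Lemma coef0_NX : (- q) 0%N = 0. Proof. by rewrite coefNE coef0_X oppr0. Qed.

Local Notation euler := (@euler R).

Lemma eulerE m : euler m = qpinf (- q ^+ m) (q ^+ m).
Proof. by rewrite unlock. Qed.

Lemma coef0_euler m : (0 < m)%N -> euler m 0%N = 1.
Proof. by move=> m0; rewrite eulerE; apply: qpinf_coef0 (coef0_NXn m0). Qed.

Lemma dilate_euler m n : (0 < m)%N -> (0 < n)%N ->
  dilate m (euler n) = euler (m * n).
Proof.
move=> m0 n0; rewrite !eulerE (dilate_qpinf m0 (coef0_NXn n0) (coef0_Xn n0)).
by rewrite rmorphN !rmorphXn /= !(dilateX _ m0) -exprM.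
Qed.

Lemma qpinf_blocks2 a Q : a 0%N = 0 -> Q 0%N = 0 ->
  qpinf a Q = qpinf a (Q ^+ 2) * qpinf (a * Q) (Q ^+ 2).
Proof.
by move=> a0 Q0; rewrite (@qpinf_blocks _ 2) // !big_ord_recr big_ord0 /= mul1r mulr1.
Qed.

Lemma qpinf_blocks3 a Q : a 0%N = 0 -> Q 0%N = 0 ->
  qpinf a Q = qpinf a (Q ^+ 3) * qpinf (a * Q) (Q ^+ 3)
              * qpinf (a * Q ^+ 2) (Q ^+ 3).
Proof.
by move=> a0 Q0; rewrite (@qpinf_blocks _ 3) // !big_ord_recr big_ord0 /= mul1r mulr1.
Qed.

Lemma euler_odd m : (0 < m)%N ->
  euler m = qpinf (- q ^+ m) (q ^+ (2 * m)) * euler (2 * m).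
Proof.
move=> m0; rewrite !eulerE (qpinf_blocks2 (coef0_NXn m0) (coef0_Xn m0)).
by rewrite mulNr -exprD -exprM addnn mul2n -muln2.
Qed.

Lemma qpinf_pos_euler m : (0 < m)%N ->
  qpinf (q ^+ m) (q ^+ m) * euler m = euler (2 * m).
Proof.
by move=> m0; rewrite !eulerE (qpinf_conj (coef0_Xn m0) (coef0_Xn m0)) -!exprM mulnC.
Qed.

Lemma qpinf_pos_odd m : (0 < m)%N ->
  qpinf (q ^+ m) (q ^+ (2 * m)) * qpinf (- q ^+ m) (q ^+ (2 * m)) * euler (4 * m)
    = euler (2 * m).
Proof.
move=> m0; have m2 : (0 < 2 * m)%N by rewrite muln_gt0.
rewrite (qpinf_conj (coef0_Xn m0) (coef0_Xn m2)) -!exprM.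
by rewrite (euler_odd m2) !mulnA (mulnC m) (mulnAC 2 m 2).
Qed.

(** Ramanujan's psi(q), phi(q) and phi(-q), then the functions f(q, q^2) and f(-q, -q^5) that occur
    in the 3-dissections of psi(q) and phi(-q). *)
Definition psi := theta q (q ^+ 3).
Definition phi := theta q q.
Definition phiN := theta (- q) (- q).
Definition theta12 := theta q (q ^+ 2).
Definition theta15 := theta (- q) (- q ^+ 5).

(** The triple product gives (-q; q^2)_oo f_4, while f_1 = (q; q^2)_oo f_2 and (-q; q^2)_oo (q;
    q^2)_oo f_4 = f_2. *)
Lemma psi_euler : psi * euler 1 = euler 2 ^+ 2.
Proof.
rewrite /psi (jacobi_triple_product coef0_X (coef0_Xn (isT : 0 < 3)%N)).
rewrite -exprS -(eulerE 4).
have -> : qpinf q (q ^+ 4) * qpinf (q ^+ 3) (q ^+ 4) = qpinf q (q ^+ 2).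
  rewrite [RHS](qpinf_blocks2 coef0_X (coef0_Xn (isT : 0 < 2)%N)) -exprS.
  by rewrite -exprM.
rewrite (@euler_odd 1) // expr1.
by have := @qpinf_pos_odd 1 isT; rewrite !muln1 expr1 => <-; qring.
Qed.

Lemma phiN_euler : phiN * euler 2 = euler 1 ^+ 2.
Proof.
rewrite /phiN (jacobi_triple_product coef0_NX coef0_NX) mulrNN -(expr2 q) -(eulerE 2).
by rewrite (@euler_odd 1) // expr1 muln1; qring.
Qed.

(** The factors (-q; q^3)_oo and (-q^2; q^3)_oo of the triple product complete (-q^3; q^3)_oo = f_6
    / f_3 to (-q; q)_oo = f_2 / f_1. *)
Lemma theta12_euler : theta12 * euler 1 * euler 6 = euler 2 * euler 3 ^+ 2.
Proof.
rewrite /theta12 (jacobi_triple_product coef0_X (coef0_Xn (isT : 0 < 2)%N)).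
rewrite -exprS -(eulerE 3).
have e6 : _ = euler 6 := qpinf_pos_euler (isT : 0 < 3)%N.
have e2 : _ = euler 2 := qpinf_pos_euler (isT : 0 < 1)%N.
rewrite -e6 -e2 !expr1 (qpinf_blocks3 coef0_X coef0_X) -exprS -(expr2 q); qring.
Qed.

(** Odd numbers are 1, 3 or 5 modulo 6, so the product is (q; q^2)_oo / (q^3; q^6)_oo, that is (f_1
    / f_2) (f_6 / f_3). *)
Lemma qpinf_pm1_mod6 :
  qpinf (- q) (q ^+ 6) * qpinf (- q ^+ 5) (q ^+ 6) * euler 2 * euler 3
    = euler 1 * euler 6.
Proof.
have e3 : euler 3 = qpinf (- q ^+ 3) (q ^+ 6) * euler 6 :=
  euler_odd (isT : 0 < 3)%N.
have b3 : qpinf (- q) (q ^+ 2) =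
    qpinf (- q) (q ^+ 6) * qpinf (- q ^+ 3) (q ^+ 6) * qpinf (- q ^+ 5) (q ^+ 6).
  rewrite (qpinf_blocks3 coef0_NX (coef0_Xn (isT : 0 < 2)%N)).
  by rewrite !mulNr -!exprM -!exprS.
by rewrite e3 (@euler_odd 1) // expr1 muln1 b3; qring.
Qed.

Lemma theta15_euler : theta15 * euler 2 * euler 3 = euler 1 * euler 6 ^+ 2.
Proof.
rewrite /theta15 (jacobi_triple_product coef0_NX (coef0_NXn (isT : 0 < 5)%N)).
rewrite mulrNN -exprS -(eulerE 6) expr2 mulrA -qpinf_pm1_mod6; qring.
Qed.

Lemma theta12_theta15 : theta12 * theta15 = euler 3 * euler 6.
Proof.
have c0 : (euler 1 * euler 6 * (euler 2 * euler 3)) 0%N = 1.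
  by rewrite !coef0M !coef0_euler // !mulr1.
apply: (ps_mulI c0).
transitivity ((theta12 * euler 1 * euler 6) * (theta15 * euler 2 * euler 3)).
  by qring.
by rewrite theta12_euler theta15_euler; qring.
Qed.

Lemma negX_euler1 : negX (euler 1) * euler 1 * euler 4 = euler 2 ^+ 3.
Proof.
rewrite {1}eulerE (negX_qpinf (coef0_NXn (isT : 0 < 1)%N) (coef0_Xn (isT : 0 < 1)%N)).
rewrite rmorphN !rmorphXn /= negX_X !expr1 opprK.
rewrite (qpinf_blocks2 coef0_X coef0_NX) sqrrN mulrN -(expr2 q) -(eulerE 2).
rewrite (@euler_odd 1) // expr1.
by have := @qpinf_pos_odd 1 isT; rewrite !muln1 expr1 => <-; qring.
Qed.

Lemma negX_euler_even m : (0 < m)%N -> ~~ odd m -> negX (euler m) = euler m.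
Proof.
move=> m0 om.
have -> : euler m = dilate m (euler 1) by rewrite dilate_euler // muln1.
by rewrite negX_dilate_even.
Qed.

(** By multiplicativity, factors 1 - q^n with n prime to 3 are their own norm and contribute f_1 /
    f_3, while each 1 - q^(3k) has norm (1 - q^k)^3, contributing f_1^3. *)
Lemma norm3_euler1 : norm3 (euler 1) * euler 3 = euler 1 ^+ 4.
Proof.
have cX i : (0 < i)%N -> ps_cvg (qpoch (- q ^+ i) (q ^+ 3)) (qpinf (- q ^+ i) (q ^+ 3)).
  by move=> i0; exact: qpinf_cvg (coef0_NXn i0) (coef0_Xn (isT : 0 < 3)%N).
have c1 : ps_cvg (qpoch (- q) q) (euler 1).
  by rewrite !eulerE !expr1; exact: qpinf_cvg coef0_NX coef0_X.
have -> : norm3 (euler 1) =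
    qpinf (- q ^+ 1) (q ^+ 3) * qpinf (- q ^+ 2) (q ^+ 3) * euler 1 ^+ 3.
  (* Taking 3n factors at a time gives n factors in each residue class. *)
  have := ps_cvg_norm3 (ps_cvg_sub (fun n => leq_pmull n (isT : 0 < 3)%N) c1).
  move/ps_cvg_unique; apply.
  apply: ps_cvg_ext (ps_cvgM (ps_cvgM (cX 1 isT) (cX 2 isT)) (ps_cvgX 3 c1)) => n /=.
  rewrite qpoch_blocks !big_ord_recr big_ord0 /= mul1r expr0 mulr1 !norm3M !expr1.
  rewrite !mulNr -!exprS.
  have norm3_qpoch i : qpoch (- q ^+ i) (q ^+ 3) n =
      \prod_(k < n) (1 - q ^+ (3 * k + i)).
    by apply: eq_bigr => k _; rewrite -exprM mulNr -exprD addnC.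
  rewrite -{1 4}(expr1 q) !norm3_qpoch !(big_morph _ (@norm3M R) (norm31 R)).
  congr (_ * _ * _); last first.
    rewrite -prodrXl; apply: eq_bigr => k _.
    rewrite -norm3_dilate rmorphD rmorphM rmorphXn rmorphN rmorph1 /= dilateX //.
    by congr (norm3 (1 + _)); rewrite -exprM mulNr -exprD addnC.
  1,2: by apply: eq_bigr => k _; rewrite norm3_1subX // dvdn_addr ?dvdn_mulr.
have -> : euler 1 = qpinf (- q ^+ 1) (q ^+ 3) * qpinf (- q ^+ 2) (q ^+ 3) * euler 3.
  rewrite {1}eulerE !expr1 (qpinf_blocks3 coef0_NX coef0_X).
  by rewrite !mulNr -!exprS -(expr2 q) -(eulerE 3).
by qring.
Qed.

End ThetaFunctions.

(** * Dissections of theta functions *)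

Section Dissections.
Local Open Scope ring_scope.
Variable R : comNzRingType.
Local Notation q := (psX R).
Local Notation euler := (@euler R).
Implicit Types (y : pseries R).

Lemma rmorph_theta_psum (F : {rmorphism pseries R -> pseries R}) a b n :
  F (theta_psum a b n) = theta_psum (F a) (F b) n.
Proof.
rewrite rmorphD rmorph1 rmorph_sum; congr (1 + _); apply: eq_bigr => k _.
by rewrite rmorphD !rmorphM !rmorphXn.
Qed.

(** Partial sums at an arbitrary argument, since the dissections evaluate them at -q and at powers
    of q. *)
Definition psi_psum y n := \sum_(k < n) y ^+ 'C(k.+1, 2).

Definition phi_psum y n := 1 + 2%:R * \sum_(k < n) y ^+ (k.+1 ^ 2).

Lemma rmorph_psi_psum (F : {rmorphism pseries R -> pseries R}) y n :
  F (psi_psum y n) = psi_psum (F y) n.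
Proof. by rewrite rmorph_sum; apply: eq_bigr => k _; rewrite rmorphXn. Qed.

Lemma psi_psumS y n : psi_psum y n.+1 = psi_psum y n + y ^+ 'C(n.+1, 2).
Proof. exact: big_ord_recr. Qed.

Lemma phi_psumS y n : phi_psum y n.+1 = phi_psum y n + 2%:R * y ^+ (n.+1 ^ 2).
Proof. by rewrite /phi_psum big_ord_recr mulrDr addrA. Qed.

Lemma theta_psumS (a b : pseries R) n :
  theta_psum a b n.+1 = theta_psum a b n + theta_summand a b n.
Proof. by rewrite /theta_psum big_ord_recr addrA. Qed.

Lemma bin2_double k : ('C(k.+1, 2) * 2 = k.+1 * k)%N.
Proof. by elim: k => // k IH; rewrite binS2; lia. Qed.

(** In f(y, y^3) the indices n+1 and -(n+1) contribute two consecutive triangular exponents. *)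
Lemma theta_psum_psi y n : theta_psum y (y ^+ 3) n = psi_psum y (2 * n).+1.
Proof.
elim: n => [|n IH]; first by rewrite /theta_psum /psi_psum big_ord0 big_ord1 addr0.
have -> : ((2 * n.+1).+1 = (2 * n).+3)%N by lia.
have [[[b1 b2] b3] b4] := (bin2_double n, bin2_double n.+1,
  bin2_double (2 * n).+1, bin2_double (2 * n).+2).
rewrite theta_psumS IH !psi_psumS -!addrA /theta_summand -!exprM -!exprD.
have -> : ('C((2 * n).+2, 2) = 'C(n.+2, 2) + 3 * 'C(n.+1, 2))%N by nia.
by have -> : ('C((2 * n).+3, 2) = 'C(n.+1, 2) + 3 * 'C(n.+2, 2))%N by nia.
Qed.

Lemma theta_psum_phi y n : theta_psum y y n = phi_psum y n.
Proof.
rewrite /theta_psum /phi_psum mulr_sumr; congr (1 + _); apply: eq_bigr => k _.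
rewrite /theta_summand -!exprD addnC; have -> : ('C(k.+1, 2) + 'C(k.+2, 2) = k.+1 ^ 2)%N.
  by have := (bin2_double k, bin2_double k.+1) => -[]; nia.
by ring.
Qed.

(** The triangular numbers k(k+1)/2 with k = 3n+1 are 9 n(n+1)/2 + 1; the others are multiples of 3
    and pair up into the summands of f(y^3, y^6). *)
Lemma psi_psum3 y n :
  psi_psum y (3 * n).+1 = theta_psum (y ^+ 3) (y ^+ 6) n + y * psi_psum (y ^+ 9) n.
Proof.
elim: n => [|n IH].
  by rewrite /theta_psum /psi_psum !big_ord0 big_ord1 mulr0 !addr0.
have [[[[b1 b2] b3] b4] b5] := (bin2_double n, bin2_double n.+1,
  bin2_double (3 * n).+1, bin2_double (3 * n).+2, bin2_double (3 * n).+3).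
have -> : ((3 * n.+1).+1 = (3 * n).+4)%N by lia.
rewrite 3!psi_psumS IH psi_psumS theta_psumS /theta_summand -!exprM -!exprD.
have -> : ('C((3 * n).+2, 2) = (9 * 'C(n.+1, 2)).+1)%N by nia.
have -> : ('C((3 * n).+3, 2) = 3 * 'C(n.+2, 2) + 6 * 'C(n.+1, 2))%N by nia.
have -> : ('C((3 * n).+4, 2) = 3 * 'C(n.+1, 2) + 6 * 'C(n.+2, 2))%N by nia.
by rewrite [y ^+ (9 * _).+1]exprS; ring.
Qed.

(** An odd square is 1 plus 8 times a triangular number. *)
Lemma phi_psum2 y n :
  phi_psum y (2 * n) = phi_psum (y ^+ 4) n + 2%:R * y * psi_psum (y ^+ 8) n.
Proof.
elim: n => [|n IH].
  by rewrite muln0 /phi_psum /psi_psum !big_ord0 !mulr0 !addr0.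
have b1 := bin2_double n.
have -> : (2 * n.+1 = (2 * n).+2)%N by lia.
rewrite 2!phi_psumS IH phi_psumS psi_psumS -!exprM.
have -> : ((2 * n).+1 ^ 2 = (8 * 'C(n.+1, 2)).+1)%N by nia.
have -> : ((2 * n).+2 ^ 2 = 4 * n.+1 ^ 2)%N by nia.
by rewrite [y ^+ (8 * _).+1]exprS; ring.
Qed.

(** Squares of multiples of 3 give the first term; the squares of 3n+2 and 3n+4 pair up into one
    summand of f(y^3, y^15), shifted by 1. *)
Lemma phi_psum3 y n : phi_psum y (3 * n).+1 =
  phi_psum (y ^+ 9) n + 2%:R * y * theta_psum (y ^+ 3) (y ^+ 15) n.
Proof.
elim: n => [|n IH].
  by rewrite /phi_psum /theta_psum !big_ord0 big_ord1 expr1 !mulr0 !addr0 mulr1.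
have [b1 b2] := (bin2_double n, bin2_double n.+1).
have -> : ((3 * n.+1).+1 = (3 * n).+4)%N by lia.
rewrite 3!phi_psumS IH phi_psumS theta_psumS /theta_summand -!exprM -!exprD.
have -> : ((3 * n).+2 ^ 2 = (3 * 'C(n.+2, 2) + 15 * 'C(n.+1, 2)).+1)%N by nia.
have -> : ((3 * n).+3 ^ 2 = 9 * n.+1 ^ 2)%N by nia.
have -> : ((3 * n).+4 ^ 2 = (3 * 'C(n.+1, 2) + 15 * 'C(n.+2, 2)).+1)%N by nia.
by rewrite ![y ^+ (3 * _ + 15 * _).+1]exprS; ring.
Qed.

Lemma psi_psum_cvg : ps_cvg (psi_psum q) (psi R).
Proof.
have c : ps_cvg (psi_psum q) (ps_lim (psi_psum q)).
  apply: ps_lim_cvg => n; rewrite /psi_psum big_ord_recr addrC addKr /=.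
  exact: low_order_expr (coef0_X R) (leq_binS2 n).
suff <- : ps_lim (psi_psum q) = psi R by [].
have c' := theta_cvg (coef0_X R) (coef0_Xn R (isT : 0 < 3)%N).
apply: ps_cvg_unique c'; have le n : (n <= (2 * n).+1)%N by lia.
by apply: ps_cvg_ext (ps_cvg_sub le c) => n; rewrite /= theta_psum_psi.
Qed.

Lemma theta12_cvg : ps_cvg (theta_psum q (q ^+ 2)) (theta12 R).
Proof. exact: theta_cvg (coef0_X R) (coef0_Xn R (isT : 0 < 2)%N). Qed.

Lemma psi_dissect3 : psi R = dilate 3 (theta12 R) + dilate 9 (psi R) * q.
Proof.
have le n : (n <= (3 * n).+1)%N by lia.
apply: (ps_cvg_unique (ps_cvg_sub le psi_psum_cvg)).
have c3 := ps_cvg_dilate (isT : 0 < 3)%N theta12_cvg.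
have c9 := ps_cvg_dilate (isT : 0 < 9)%N psi_psum_cvg.
apply: ps_cvg_ext (ps_cvgD c3 (ps_cvgM c9 (ps_cvg_cst q))) => n /=.
rewrite psi_psum3 rmorph_theta_psum rmorph_psi_psum rmorphXn /=.
by rewrite !dilateX // -exprM mulrC.
Qed.

Lemma phiN_dissect2 :
  phiN R = dilate 4 (phi R) - 2%:R * q * dilate 8 (psi R).
Proof.
have le n : (n <= 2 * n)%N by lia.
have c := theta_cvg (coef0_NX R) (coef0_NX R).
apply: (ps_cvg_unique (ps_cvg_sub le c)).
have c4 := ps_cvg_dilate (isT : 0 < 4)%N (theta_cvg (coef0_X R) (coef0_X R)).
have c8 := ps_cvg_dilate (isT : 0 < 8)%N psi_psum_cvg.
have cq := ps_cvgN (ps_cvgM (ps_cvg_cst (2%:R * q)) c8).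
apply: ps_cvg_ext (ps_cvgD c4 cq) => n /=.
rewrite rmorph_theta_psum rmorph_psi_psum /= (dilateX R (isT : 0 < 4)%N).
rewrite (dilateX R (isT : 0 < 8)%N) !theta_psum_phi phi_psum2.
have -> : (- q) ^+ 4 = q ^+ 4 by ring.
have -> : (- q) ^+ 8 = q ^+ 8 by ring.
by rewrite mulrN mulNr.
Qed.

Lemma phiN_dissect3 :
  phiN R = dilate 9 (phiN R) - 2%:R * q * dilate 3 (theta15 R).
Proof.
have le n : (n <= (3 * n).+1)%N by lia.
have c := theta_cvg (coef0_NX R) (coef0_NX R).
apply: (ps_cvg_unique (ps_cvg_sub le c)).
have c9 := ps_cvg_dilate (isT : 0 < 9)%N c.
have c15 := theta_cvg (coef0_NX R) (coef0_NXn R (isT : 0 < 5)%N).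
have c3 := ps_cvg_dilate (isT : 0 < 3)%N c15.
have cq := ps_cvgN (ps_cvgM (ps_cvg_cst (2%:R * q)) c3).
apply: ps_cvg_ext (ps_cvgD c9 cq) => n /=.
rewrite !rmorph_theta_psum /= !rmorphN !rmorphXn /= (dilateX R (isT : 0 < 9)%N).
rewrite (dilateX R (isT : 0 < 3)%N) !theta_psum_phi phi_psum3.
have -> : (- q) ^+ 9 = - q ^+ 9 by ring.
have -> : (- q) ^+ 3 = - q ^+ 3 by ring.
have -> : (- q) ^+ 15 = - q ^+ 15 by ring.
by rewrite mulrN mulNr -exprM.
Qed.

End Dissections.

(** * The residue class 1 modulo 3 *)

Section ResidueOne.
Local Open Scope ring_scope.
Variable R : comNzRingType.
Local Notation q := (psX R).
Local Notation euler := (@euler R).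
Local Notation psi := (psi R).
Local Notation theta12 := (theta12 R).

Lemma coef0_psi : psi 0%N = 1.
Proof.
have := congr1 (fun f : pseries R => f 0%N) (psi_euler R).
by rewrite coef0M coef0X !coef0_euler // expr1n mulr1.
Qed.

Lemma dilate3_psi_euler : dilate 3 psi * euler 3 = euler 6 ^+ 2.
Proof.
have := congr1 (dilate 3) (psi_euler R).
by rewrite rmorphM rmorphXn /= !dilate_euler.
Qed.

Lemma norm3_psi : norm3 psi = theta12 ^+ 3 + q * dilate 3 psi ^+ 3.
Proof.
rewrite (@norm3E _ psi theta12 (dilate 3 psi) 0); first by ring.
by rewrite dilate_comp rmorph0 mul0r addr0 -psi_dissect3.
Qed.

(** Take norms in psi(q) f_1 = f_2^2; the norm of f_2 is that of f_1 with q^2 for q. *)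
Lemma norm3_psi_euler :
  norm3 psi * euler 1 ^+ 4 * euler 6 ^+ 2 = euler 2 ^+ 8 * euler 3.
Proof.
have e1 := norm3_euler1 R.
have e2 : norm3 (euler 2) * euler 6 = euler 2 ^+ 4.
  have := congr1 (dilate 2) e1; rewrite rmorphM rmorphXn /= -norm3_dilate2.
  by rewrite !dilate_euler.
have np := congr1 (@norm3 R) (psi_euler R).
rewrite expr2 !norm3M in np.
rewrite -e1 mulrA np -[8%N]/(4 * 2)%N exprM -e2.
ring.
Qed.

(** With psi = A(q^3) + q P(q^3), rationalising gives 1 / psi = (A^2 - q A P + q^2 P^2) / (A^3 + q^3
    P^3), all taken at q^3, so the slice is -A P over the norm of psi. *)
Lemma slice_inv_psi f : psi * f = 1 ->
  slice 3 1 f * euler 2 ^+ 7 = - (euler 1 ^+ 3 * euler 6 ^+ 3).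
Proof.
move=> pf; set P := dilate 3 psi; set A := theta12.
have fK : dilate 3 (norm3 psi) * f =
    dilate 3 (A ^+ 2) + dilate 3 (- (A * P)) * q + dilate 3 (P ^+ 2) * q ^+ 2.
  set K := RHS; transitivity (psi * K * f); last by rewrite mulrAC pf mul1r.
  have psE : psi = dilate 3 A + dilate 3 P * q by rewrite dilate_comp -psi_dissect3.
  rewrite norm3_psi -/A -/P psE /K.
  rewrite !(rmorphD, rmorphN, rmorphM, rmorphXn) /= (dilateX R (isT : 0 < 3)%N).
  by qring.
have [_ fA _] := slice3E fK; rewrite slice_dilateM // in fA.
have nE := norm3_psi_euler.
have AE : A * euler 1 * euler 6 = euler 2 * euler 3 ^+ 2 := theta12_euler R.
have PE : P * euler 3 = euler 6 ^+ 2 := dilate3_psi_euler.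
have c0 : (euler 2 * euler 3 ^+ 2) 0%N = 1.
  by rewrite coef0M coef0X !coef0_euler // expr1n mulr1.
apply: (ps_mulI c0).
transitivity (slice 3 1 f * (euler 2 ^+ 8 * euler 3) * euler 3); first by qring.
rewrite -nE -AE.
transitivity (norm3 psi * slice 3 1 f * euler 1 ^+ 4 * euler 6 ^+ 2 * euler 3).
  by qring.
rewrite fA; transitivity (- A * (P * euler 3) * euler 1 ^+ 4 * euler 6 ^+ 2).
  by qring.
by rewrite PE; qring.
Qed.

Lemma negX_psi_euler : negX psi * euler 2 = euler 1 * euler 4.
Proof.
have np : negX psi * negX (euler 1) = euler 2 ^+ 2.
  have := congr1 (@negX R) (psi_euler R).
  by rewrite rmorphM rmorphXn /= [negX (euler 2)]negX_euler_even.
have nE := negX_euler1 R.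
have c0 : (euler 2 ^+ 2) 0%N = 1 by rewrite coef0X coef0_euler // expr1n.
apply: (ps_mulI c0); rewrite -{2}np.
transitivity (negX psi * euler 2 ^+ 3); first by qring.
by rewrite -nE; qring.
Qed.

(** Here f is f_3 / f_6 times 1 / psi(-q), and the first factor, a series in q^3, comes out of the
    slice. *)
Lemma slice31_generating f : f * euler 1 * euler 4 * euler 6 = euler 2 * euler 3 ->
  slice 3 1 f * euler 1 ^+ 2 * euler 4 ^+ 3 = euler 2 * euler 6 ^+ 3.
Proof.
move=> fE.
have [g pg] := ps_invP coef0_psi.
have c k m : (0 < k)%N -> (euler k ^+ m) 0%N = 1.
  by move=> k0; rewrite coef0X coef0_euler // expr1n.
have [h h2] : exists h, euler 2 * h = 1 by apply: ps_invP; rewrite coef0_euler.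
have hE : dilate 3 (euler 1 * h) * euler 6 = euler 3.
  have := congr1 (dilate 3) h2; rewrite !rmorphM rmorph1 /= !dilate_euler // => h6.
  by rewrite mulrAC -mulrA h6 mulr1.
have gE : negX g * (euler 1 * euler 4) = euler 2.
  have := congr1 (@negX R) pg; rewrite rmorphM rmorph1 /= => npg.
  by rewrite -negX_psi_euler mulrA [negX g * _]mulrC npg mul1r.
have {fE} -> : f = dilate 3 (euler 1 * h) * negX g.
  have c0 : (euler 1 * euler 4 * euler 6) 0%N = 1.
    by rewrite !coef0M !coef0_euler // !mulr1.
  apply: (ps_mulI c0).
  transitivity (f * euler 1 * euler 4 * euler 6); first by qring.
  rewrite fE -{1}gE -hE; qring.
(* The sign from [slice_negX_odd] cancels the one in [slice_inv_psi]; f_1(-q)^3 is then removed by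
   [negX_euler1]. *)
rewrite slice_dilateM // slice_negX_odd // mulrN.
have := congr1 (@negX R) (slice_inv_psi pg); move: (slice 3 1 g) => s.
rewrite rmorphN /= [negX (s * _)]rmorphM [negX (euler 1 ^+ 3 * _)]rmorphM.
rewrite !rmorphXn /= ![negX (euler 2)]negX_euler_even //.
rewrite [negX (euler 6)]negX_euler_even // => sE.
have nE := negX_euler1 R.
have c0 : (euler 2 ^+ 8 * euler 1) 0%N = 1 by rewrite coef0M c // coef0_euler // mulr1.
apply: (ps_mulI c0).
transitivity (- (negX s * euler 2 ^+ 7) * (euler 2 * h) * euler 1 ^+ 4 * euler 4 ^+ 3).
  by qring.
rewrite sE h2.
transitivity ((negX (euler 1) * euler 1 * euler 4) ^+ 3 * euler 1 * euler 6 ^+ 3).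
  by qring.
by rewrite nE; qring.
Qed.

End ResidueOne.

(** * The generating function of dp *)

Section PartitionGeneratingFunction.
Local Open Scope ring_scope.
Variable R : comNzRingType.
Local Notation q := (psX R).
Local Notation euler := (@euler R).

(** Bounding the parts by M leaves a finite product and allows induction on M. *)
Definition bounded_dp M n (s : seq nat) : bool :=
  [&& is_partition n s, all dp_part s & all (fun x => (x <= M)%N) s].

Definition dp_factor k : pseries R :=
  if dp_part k.+1 then 1 - q ^+ k.+1 else 1.

Lemma is_partition_cons n x s :
  is_partition n (x :: s)
    = [&& (0 < x <= n)%N, all (geq x) s & is_partition (n - x) s].
Proof.
rewrite /is_partition /= path_sortedE; last by move=> a b c /=; lia.
case: (sorted _ s); rewrite /= ?andbF //.
case: (all _ s); rewrite /= ?andbF //; case: (all _ s); rewrite /= ?andbF //.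
by rewrite !andbT; apply/idP/idP; lia.
Qed.

Lemma bounded_dp_nil M n : bounded_dp M n [::] = (n == 0%N).
Proof. by rewrite /bounded_dp /is_partition /= andbT eq_sym. Qed.

Lemma bounded_dp_cons M n x s : bounded_dp M n (x :: s) =
  [&& (0 < x <= n)%N, (x <= M)%N, dp_part x & bounded_dp x (n - x) s].
Proof.
rewrite /bounded_dp is_partition_cons /=.
case: (_ <= n)%N; rewrite ?andbF //= andbT.
case: (0 < x)%N => //=; case: (dp_part x); rewrite ?andbF //=.
case: (is_partition _ s); rewrite ?andbF //= andbT.
case: (all dp_part s); rewrite ?andbF //= andbC -andbA.
have [xM|] //= := leqP x M; rewrite andbC; case: (boolP (all (geq x) s)) => //.
by move=> sx; apply: sub_all sx => y /= yx; apply: leq_trans yx xM.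
Qed.

Lemma bounded_dp0 n s : bounded_dp 0 n s = (s == [::]) && (n == 0%N).
Proof.
case: s => [|x s]; first by rewrite bounded_dp_nil.
by rewrite bounded_dp_cons; case: x => //= x; rewrite !andbF.
Qed.

Lemma bounded_dpS M n s : bounded_dp M.+1 n s =
  bounded_dp M n s || [&& dp_part M.+1, (M < n)%N, head 0%N s == M.+1
                        & bounded_dp M.+1 (n - M.+1) (behead s)].
Proof.
case: s => [|x s]; first by rewrite !bounded_dp_nil /= !andbF orbF.
rewrite !bounded_dp_cons /=; have [->|xM] := eqVneq x M.+1.
  by rewrite leqnn ltnn !andbF /= andbCA.
by rewrite !andbF orbF [(x <= M.+1)%N]leq_eqVlt (negPf xM) ltnS.
Qed.

(** A partition either avoids the part M+1 or begins with it, and then that part can be removed.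
    This is the recurrence satisfied by f when f (1 - q^(M+1)) is the series for M. *)
Lemma bounded_dp_list M (f : pseries R) :
    (\prod_(k < M) dp_factor k) * f = 1 ->
  forall n, exists L : seq (seq nat),
    [/\ uniq L, forall s, (s \in L) = bounded_dp M n s & (size L)%:R = f n].
Proof.
elim: M f => [|M IHM] f.
  rewrite big_ord0 mul1r => -> n; exists (if n == 0%N then [:: [::]] else [::]).
  split=> [|s|]; first by case: ifP.
    by rewrite bounded_dp0; case: ifP; rewrite ?inE ?andbT ?andbF.
  by rewrite coef1E; case: ifP.
rewrite big_ord_recr -mulrA => /IHM {}IHM; rewrite /= /dp_factor in IHM.
case: (boolP (dp_part M.+1)) IHM => pM IHM n; last first.
  have [L [uL mL sL]] := IHM n; exists L; split=> // [s|].
    by rewrite mL bounded_dpS (negPf pM) orbF.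
  by rewrite sL mul1r.
(* Strong induction on n, since the part M+1 may be repeated. *)
have [k] := ubnP n; elim: k n => // k IHk n; rewrite ltnS => nk.
have [L [uL mL sL]] := IHM n.
have fE : f n = (size L)%:R + (if (n < M.+1)%N then 0 else f (n - M.+1)%N).
  by rewrite sL -coef_psXnM -coefDE mulrBl mul1r subrK.
have [nM|Mn] := ltnP n M.+1.
  exists L; split=> // [s|]; last by rewrite fE nM addr0.
  by rewrite mL bounded_dpS [(M < n)%N]ltnNge -ltnS nM /= andbF orbF.
have [L' [uL' mL' sL']] := IHk (n - M.+1)%N ltac:(lia).
exists (L ++ map (cons M.+1) L'); split=> [|s|].
- rewrite cat_uniq uL map_inj_uniq ?uL' ?andbT; last by move=> ? ? [].
  apply/hasPn => _ /mapP[s _ ->]; rewrite mL /bounded_dp /=.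
  by rewrite ltnn !andbF.
- rewrite mem_cat mL bounded_dpS pM Mn /=; congr (_ || _).
  case: s => [|x s]; first by apply/mapP => -[].
  apply/mapP/andP => /= [[t tL [-> ->]]|[/eqP -> sL'']].
    by rewrite eqxx -mL'.
  by exists s => //; rewrite mL'.
- by rewrite size_cat size_map natrD sL' fE ltnNge Mn.
Qed.

Lemma dp_bounded M (f : pseries R) n :
  (\prod_(k < M) dp_factor k) * f = 1 -> (n <= M)%N -> (dp n)%:R = f n.
Proof.
move=> /bounded_dp_list/(_ n)[L [uL mL <-]] nM; congr _%:R.
pose t (s : {bseq n of 'I_n.+1}) := map val s.
rewrite /dp cardE -(size_map t); apply: perm_size; apply: uniq_perm => //.
  rewrite map_inj_uniq ?enum_uniq // => s1 s2 /inj_map-/(_ val_inj) s12.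
  exact: val_inj.
move=> s; rewrite mL /bounded_dp; apply/mapP/idP => [[u]|/and3P[ps ds _]].
  rewrite mem_enum inE => /andP[pu du] ->; rewrite pu du /=.
  by apply/allP => _ /mapP[i _ ->]; apply: leq_trans nM; rewrite -ltnS ltn_ord.
have [u uE] := is_partition_bseq ps.
by exists u; rewrite ?uE // mem_enum inE -uE ps.
Qed.

Definition dp_series : pseries R := mkps (fun n => (dp n)%:R).

(** As 12 is the lcm of 4 and 6, the first 12n factors form whole periods of both conditions. *)
Lemma dp_factor_prod n : \prod_(k < 12 * n) dp_factor k =
  qpoch (- q) (q ^+ 6) (2 * n) * qpoch (- q ^+ 5) (q ^+ 6) (2 * n)
  * qpoch (- q ^+ 4) (q ^+ 4) (3 * n).
Proof.
(* Index k stands for the part k+1, so residues are shifted by one. The conditions modulo 6 and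
   modulo 4 exclude each other, whence a product of two factors. *)
pose A k : pseries R :=
  if (k %% 6 == 0)%N || (k %% 6 == 4)%N then 1 - q ^+ k.+1 else 1.
pose B k : pseries R := if (k %% 4 == 3)%N then 1 - q ^+ k.+1 else 1.
have AB k : dp_factor k = A k * B k.
  rewrite /dp_factor /A /B.
  have -> : dp_part k.+1 = (((k %% 6 == 0) || (k %% 6 == 4)) || (k %% 4 == 3))%N.
    by rewrite /dp_part; lia.
  have : (~~ [&& (k %% 6 == 0) || (k %% 6 == 4) & (k %% 4 == 3)])%N by lia.
  by case: (_ || _) => /=; case: (_ == _) => //=; rewrite ?mulr1 ?mul1r.
under eq_bigr => k _ do rewrite AB.
rewrite big_split /=; congr (_ * _).
  have -> : (12 * n = 6 * (2 * n))%N by lia.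
  rewrite big_blocks -big_split /=; apply: eq_bigr => k _.
  rewrite !big_ord_recr big_ord0 /= /A mulnC !modnMDl /= !mul1r !mulr1.
  rewrite -!exprM !mulNr -!exprD -exprS [(6 * k)%N]mulnC.
  have -> : ((k * 6 + 4).+1 = 5 + k * 6)%N by lia.
  by rewrite addn0.
have -> : (12 * n = 4 * (3 * n))%N by lia.
rewrite big_blocks; apply: eq_bigr => k _.
rewrite !big_ord_recr big_ord0 /= /B mulnC !modnMDl /= !mul1r.
rewrite -exprM mulNr -exprD [(4 * k)%N]mulnC.
by have -> : ((k * 4 + 3).+1 = 4 + k * 4)%N by lia.
Qed.

Lemma dp_series_euler :
  dp_series * euler 1 * euler 4 * euler 6 = euler 2 * euler 3.
Proof.
have c6 i : (0 < i)%N ->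
    ps_cvg (fun n => qpoch (- q ^+ i) (q ^+ 6) (2 * n)) (qpinf (- q ^+ i) (q ^+ 6)).
  move=> i0; have c := qpinf_cvg (coef0_NXn R i0) (coef0_Xn R (isT : 0 < 6)%N).
  by apply: (ps_cvg_sub _ c) => n; lia.
have c4 : ps_cvg (fun n => qpoch (- q ^+ 4) (q ^+ 4) (3 * n)) (euler 4).
  have c := qpinf_cvg (coef0_NXn R (isT : 0 < 4)%N) (coef0_Xn R (isT : 0 < 4)%N).
  by rewrite eulerE; apply: (ps_cvg_sub _ c) => n; lia.
have dpE : dp_series * (qpinf (- q ^+ 1) (q ^+ 6) * qpinf (- q ^+ 5) (q ^+ 6)
    * euler 4) = 1.
  have c := ps_cvgM (ps_cvgM (c6 1%N isT) (c6 5%N isT)) c4.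
  apply: (ps_cvg_unique (ps_cvgM (ps_cvg_cst dp_series) c)) => N.
  exists N => n Nn; rewrite expr1 -dp_factor_prod.
  (* The inverse f of the truncated product agrees with [dp_series] up to degree 12n. *)
  have [f pf] : exists f, (\prod_(k < 12 * n) dp_factor k) * f = 1.
    apply: ps_invP; elim/big_ind: _ => [|x y x1 y1|k _].
    - by rewrite coef1E.
    - by rewrite coef0M x1 y1 mulr1.
    - rewrite /dp_factor; case: ifP => _; last by rewrite coef1E.
      by rewrite coefDE coef0_NXn // addr0 coef1E.
  have fp : f * \prod_(k < 12 * n) dp_factor k = 1 by rewrite mulrC.
  apply: (@eqmod_trans _ _ (f * \prod_(k < 12 * n) dp_factor k)); last by rewrite fp.
  by apply: eqmodM => // k kN; rewrite mkpsE (dp_bounded pf) //; lia.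
have zE := qpinf_pm1_mod6 R; rewrite expr1 in dpE.
transitivity (dp_series * (euler 1 * euler 6) * euler 4); first by qring.
rewrite -zE -[RHS]mul1r -dpE; qring.
Qed.

End PartitionGeneratingFunction.

(** * Congruences *)

Section Congruences.
Local Open Scope ring_scope.
Variable R : comNzRingType.
Local Notation q := (psX R).
Local Notation euler := (@euler R).
Local Notation psi := (psi R).
Local Notation phi := (phi R).
Local Notation phiN := (phiN R).
Implicit Types f g h : pseries R.

Definition cong m f g := exists h, f = g + m%:R * h.

Lemma cong_refl m f : cong m f f.
Proof. by exists 0; rewrite mulr0 addr0. Qed.

Lemma cong_sym m f g : cong m f g -> cong m g f.
Proof. by case=> h ->; exists (- h); rewrite mulrN addrK. Qed.

Lemma cong_trans m g f h : cong m f g -> cong m g h -> cong m f h.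
Proof. by case=> u -> [v ->]; exists (v + u); rewrite mulrDr addrA. Qed.

Lemma congM m f f' g g' : cong m f f' -> cong m g g' -> cong m (f * g) (f' * g').
Proof.
case=> u -> [v ->]; by exists (f' * v + u * g' + m%:R * u * v); ring.
Qed.

Lemma congMl m f g h : cong m g h -> cong m (f * g) (f * h).
Proof. exact: congM (cong_refl m f). Qed.

Lemma cong_cancel m f g h : f 0%N = 1 -> cong m (f * g) (f * h) -> cong m g h.
Proof.
move=> /ps_invP[f' ff'] fgh; rewrite -[g]mul1r -[h]mul1r -ff' [f * f']mulrC -!mulrA.
exact: congMl.
Qed.

Lemma cong_dilate m d f g : cong m f g -> cong m (dilate d f) (dilate d g).
Proof. by case=> h ->; exists (dilate d h); rewrite rmorphD rmorphM rmorph_nat. Qed.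

Lemma cong_slice m d r f g : cong m f g -> cong m (slice d r f) (slice d r g).
Proof. by case=> h ->; exists (slice d r h); rewrite !mulr_natl raddfD raddfMn. Qed.

Lemma coef0_eulerX k m : (0 < k)%N -> (euler k ^+ m) 0%N = 1.
Proof. by move=> k0; rewrite coef0X coef0_euler // expr1n. Qed.

Lemma phi_cong : cong 2 phi 1.
Proof.
pose u n := \sum_(k < n) q ^+ (k.+1 ^ 2).
have cu : ps_cvg u (ps_lim u).
  apply: ps_lim_cvg => n; rewrite /u big_ord_recr addrC addKr /=.
  by apply: low_order_expr (coef0_X R) _; nia.
exists (ps_lim u); apply: (ps_cvg_unique (theta_cvg (coef0_X R) (coef0_X R))).
apply: ps_cvg_ext (ps_cvgD (ps_cvg_cst 1) (ps_cvgM (ps_cvg_cst 2%:R) cu)) => n.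
by rewrite theta_psum_phi.
Qed.

Lemma phiN_cong : cong 2 phiN 1.
Proof.
have [x xE] := cong_dilate 4 phi_cong; rewrite rmorph1 in xE.
by exists (x - q * dilate 8 psi); rewrite phiN_dissect2 xE; ring.
Qed.

(** We have f_1^4 = phi(-q)^2 f_2^2, and (1 + 2x)^2 = 1 + 4 (x + x^2). *)
Lemma euler1_pow4_cong : cong 4 (euler 1 ^+ 4) (euler 2 ^+ 2).
Proof.
have [x xE] := phiN_cong; have pE := phiN_euler R.
exists ((x + x ^+ 2) * euler 2 ^+ 2).
by rewrite -[4%N]/(2 * 2)%N exprM -pE xE; ring.
Qed.

Lemma psi_cong : cong 4 psi (euler 1 ^+ 3).
Proof.
apply: (@cong_cancel 4 (euler 1)); first exact: coef0_euler.
rewrite mulrC psi_euler -exprS; exact: cong_sym euler1_pow4_cong.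
Qed.

Lemma psi_phiN : psi * phiN = euler 1 * euler 2.
Proof.
have c0 : (euler 1 * euler 2) 0%N = 1 by rewrite coef0M !coef0_euler // mulr1.
apply: (ps_mulI c0).
transitivity ((psi * euler 1) * (phiN * euler 2)); first by qring.
by rewrite psi_euler phiN_euler; qring.
Qed.

Lemma coef0_phiN : phiN 0%N = 1.
Proof.
have := congr1 (fun f : pseries R => f 0%N) (phiN_euler R).
by rewrite coef0M coef0_eulerX // coef0_euler // mulr1.
Qed.

(* With phi(-q) = a(q^2) - 2q b(q^2), multiplying by a(q^2) + 2q b(q^2)
   rationalises the denominator phi(-q) to an even series that is 1 mod 4. *)
Lemma slice21_euler f : f * euler 1 ^+ 2 * euler 4 ^+ 3 = euler 2 * euler 6 ^+ 3 ->
  exists2 h, slice 2 1 f = 2%:R * h & cong 4 h (euler 3 ^+ 3 * (euler 2 * euler 4)).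
Proof.
move=> fE; have [x xE] := phi_cong.
pose a := dilate 2 phi; pose b := dilate 4 psi.
pose d := a ^+ 2 - 4%:R * q * b ^+ 2.
have phiE : phiN = dilate 2 a - 2%:R * q * dilate 2 b.
  by rewrite !dilate_comp -phiN_dissect2.
have dE : dilate 2 d = phiN * (dilate 2 a + 2%:R * q * dilate 2 b).
  rewrite phiE /d rmorphB !rmorphM rmorph_nat /= (dilateX R (isT : 0 < 2)%N).
  by move: (dilate 2 a) (dilate 2 b) => a2 b2; ring.
have a0 : (dilate 2 a) 0%N = 1.
  rewrite -coef0_phiN phiE coefDE coefNE -mulrA mulrCA coef0M coef0_X mul0r.
  by rewrite oppr0 addr0.
have d0 : d 0%N = 1.
  have := congr1 (fun g : pseries R => g 0%N) dE.
  rewrite dilateE dvdn0 div0n => ->; rewrite coef0M coef0_phiN mul1r coefDE a0.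
  by rewrite -mulrA mulrCA coef0M coef0_X mul0r addr0.
have d4 : cong 4 d 1.
  have [y yE] := cong_dilate 2 phi_cong; rewrite rmorph1 in yE.
  exists (y + y ^+ 2 - q * b ^+ 2); rewrite /d /a yE; ring.
have fphi : f * phiN * euler 4 ^+ 3 = euler 6 ^+ 3.
  apply: (ps_mulI (coef0_eulerX 1 (isT : 0 < 2)%N)); rewrite expr1 -fE -phiN_euler.
  by qring.
have e4X : dilate 2 (euler 2 ^+ 3) = euler 4 ^+ 3.
  by rewrite rmorphXn /= dilate_euler.
have e6X : dilate 2 (euler 3 ^+ 3) = euler 6 ^+ 3.
  by rewrite rmorphXn /= dilate_euler.
(* Multiplying f phi(-q) f_4^3 = f_6^3 by the conjugate of phi(-q) leaves f times an even series on
   the left, so the odd part can be read off. *)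
have /(congr1 (slice 2 1)) : dilate 2 (d * euler 2 ^+ 3) * f =
    dilate 2 (euler 3 ^+ 3 * a) + dilate 2 (euler 3 ^+ 3 * (2%:R * b)) * q ^+ 1.
  have -> : dilate 2 (d * euler 2 ^+ 3) = dilate 2 d * euler 4 ^+ 3.
    by rewrite rmorphM /= e4X.
  have -> : dilate 2 (euler 3 ^+ 3 * (2%:R * b)) = euler 6 ^+ 3 * (2%:R * dilate 2 b).
    by rewrite rmorphM /= e6X rmorphM rmorph_nat.
  have -> : dilate 2 (euler 3 ^+ 3 * a) = euler 6 ^+ 3 * dilate 2 a.
    by rewrite rmorphM /= e6X.
  rewrite dE -fphi; move: (dilate 2 a) (dilate 2 b) phiN (euler 4) => a2 b2 p e.
  by ring.
rewrite slice_dilateM // raddfD /= slice_dilateMX // slice_dilate //= add0r => sE.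
have c0 : (d * euler 2 ^+ 3) 0%N = 1 by rewrite coef0M d0 coef0_eulerX // mulr1.
have [i ci] := ps_invP c0.
exists (euler 3 ^+ 3 * b * i).
  transitivity (i * (d * euler 2 ^+ 3 * slice 2 1 f)).
    by rewrite mulrA [i * _]mulrC ci mul1r.
  by rewrite sE; qring.
have b4 : cong 4 b (euler 4 ^+ 3).
  by have := cong_dilate 4 psi_cong; rewrite rmorphXn /= dilate_euler.
have e4 : cong 4 (euler 2 ^+ 4) (euler 4 ^+ 2).
  by have := cong_dilate 2 euler1_pow4_cong; rewrite !rmorphXn /= !dilate_euler.
(* Modulo 4, both sides times f_2^3 become f_3^3 f_4^3, using d = 1 and psi(q^4) = f_4^3 on one side
   and f_2^4 = f_4^2 on the other. *)
apply: (@cong_cancel 4 (euler 2 ^+ 3)); first exact: coef0_eulerX.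
set h := _ * i.
apply: (@cong_trans 4 (d * euler 2 ^+ 3 * h)).
  rewrite -mulrA -{1}[_ * h]mul1r; apply: congM (cong_refl 4 _).
  exact: cong_sym.
have -> : d * euler 2 ^+ 3 * h = euler 3 ^+ 3 * b.
  by rewrite /h mulrCA ci mulr1.
apply: (@cong_trans 4 (euler 3 ^+ 3 * euler 4 ^+ 3)); first exact: congMl.
have -> : euler 3 ^+ 3 * euler 4 ^+ 3 = euler 3 ^+ 3 * euler 4 * euler 4 ^+ 2.
  by qring.
have -> : euler 2 ^+ 3 * (euler 3 ^+ 3 * (euler 2 * euler 4)) =
    euler 3 ^+ 3 * euler 4 * euler 2 ^+ 4 by qring.
by apply: congMl; apply: cong_sym.
Qed.

Lemma euler24 : euler 2 * euler 4 = dilate 2 (psi * phiN).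
Proof. by rewrite psi_phiN rmorphM /= !dilate_euler. Qed.

Lemma euler3X m : euler 3 ^+ m = dilate 3 (euler 1 ^+ m).
Proof. by rewrite rmorphXn /= dilate_euler. Qed.

Lemma psi3 : psi =
  dilate 3 (theta12 R) + dilate 3 (dilate 3 psi) * q + dilate 3 0 * q ^+ 2.
Proof. by rewrite dilate_comp rmorph0 mul0r addr0 -psi_dissect3. Qed.

(** Modulo 2, phi(-q) is 1, so h becomes f_3^3 psi(q^2). Exponents 1 modulo 3 in psi(q^2) come from
    exponents 2 modulo 3 in psi, of which there are none. *)
Lemma slice31_cong h : cong 4 h (euler 3 ^+ 3 * (euler 2 * euler 4)) ->
  cong 2 (slice 3 1 h) 0.
Proof.
case=> u hE.
have h2 : cong 2 h (dilate 3 (euler 1 ^+ 3) * dilate 2 psi).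
  apply: (@cong_trans 2 (euler 3 ^+ 3 * (euler 2 * euler 4))).
    by exists (2%:R * u); rewrite hE [2%:R * (2%:R * u)]mulrA -natrM.
  rewrite euler3X euler24; apply: congMl; apply: cong_dilate.
  by rewrite -[X in cong 2 _ X]mulr1; apply: congMl phiN_cong.
apply: cong_trans (cong_slice 3 1 h2) _; rewrite slice_dilateM //.
have [_ -> _] := slice3E (dilate2_dissect3 psi).
by have [_ _ ->] := slice3E psi3; rewrite rmorph0 mul0r mulr0; apply: cong_refl.
Qed.

(** Doubling turns residue 1 into residue 2, so the slice 1 of psi(q) phi(-q) is wanted. It is
    psi(q) phi(-q) at q^3 minus 2 f(q, q^2) f(-q, -q^5), that is f_3 f_6 - 2 f_3 f_6. *)
Lemma slice32_euler24 : slice 3 2 (euler 2 * euler 4) = - (euler 6 * euler 12).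
Proof.
pose A := theta12 R; pose B := theta15 R.
have E : psi * phiN = dilate 3 (A * dilate 3 phiN)
    + dilate 3 (dilate 3 psi * dilate 3 phiN - 2%:R * (A * B)) * q
    + dilate 3 (- 2%:R * (dilate 3 psi * B)) * q ^+ 2.
  rewrite {1}psi_dissect3 {1}phiN_dissect3 -(dilate_comp 3 3) -(dilate_comp 3 3 phiN).
  rewrite -/A -/B; move: A B (dilate 3 psi) (dilate 3 phiN) => a b p f.
  by rewrite rmorphB !rmorphM rmorphN rmorph_nat /=; ring.
rewrite euler24; have [_ _ ->] := slice3E (dilate2_dissect3 (psi * phiN)).
have [_ -> _] := slice3E E.
have -> : dilate 3 psi * dilate 3 phiN - 2%:R * (A * B) = - (euler 3 * euler 6).
  rewrite -rmorphM /= psi_phiN theta12_theta15 rmorphM /= !dilate_euler //.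
  by qring.
by rewrite rmorphN rmorphM /= !dilate_euler.
Qed.

(** Modulo 4 the inner slice is -f_1^3 f_6 f_12, where f_1^3 may be replaced by psi, which has no
    exponent 2 modulo 3. *)
Lemma slice32_cong h : cong 4 h (euler 3 ^+ 3 * (euler 2 * euler 4)) ->
  cong 4 (slice 3 2 (slice 3 2 h)) 0.
Proof.
move=> /(cong_slice 3 2); rewrite euler3X slice_dilateM // slice32_euler24 => h4.
have {}h4 : cong 4 (slice 3 2 h) (dilate 3 (- (euler 2 * euler 4)) * psi).
  apply: cong_trans h4 _.
  rewrite rmorphN rmorphM /= !dilate_euler // mulrC; apply: congMl.
  exact: cong_sym psi_cong.
apply: cong_trans (cong_slice 3 2 h4) _; rewrite slice_dilateM //.
by have [_ _ ->] := slice3E psi3; rewrite mulr0; apply: cong_refl.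
Qed.

End Congruences.

(** * The three congruences for dp *)

Lemma dvdn_of_int_mulrn m k (x : int) : (k%:R = x *+ m)%R -> m %| k.
Proof.
by move=> /(congr1 absz); rewrite -(mulr_natr x) !natz abszM /= => ->; apply: dvdn_mull.
Qed.

Theorem theorem1p2 (n : nat) :
  [/\ dp (6 * n + 4) = 0 %[mod 2],
      dp (18 * n + 10) = 0 %[mod 4]
    & dp (54 * n + 52) = 0 %[mod 8]].
Proof.
have [h hE h4] := slice21_euler (slice31_generating (dp_series_euler int)).
(* The successive slices reach the index 3(2m+1) + 1 = 6m + 4. *)
have dpE m : ((dp (6 * m + 4))%:R = h m *+ 2 :> int)%R.
  rewrite -coefMnE -(mulr_natl h) -hE !sliceE mkpsE; congr ((dp _)%:R)%R; lia.
have [u uE] := slice31_cong h4; have [v vE] := slice32_cong h4.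
have {}uE : (h (3 * n + 1) = u n *+ 2)%R.
  by rewrite -sliceE uE coefDE mulr_natl coefMnE coef0E add0r.
have {}vE : (h (3 * (3 * n + 2) + 2) = v n *+ 4)%R.
  by rewrite -!sliceE vE coefDE mulr_natl coefMnE coef0E add0r.
split; apply/eqP; rewrite mod0n.
- exact: dvdn_of_int_mulrn (dpE n).
- apply: (@dvdn_of_int_mulrn _ _ (u n)).
  have -> : 18 * n + 10 = 6 * (3 * n + 1) + 4 by lia.
  by rewrite dpE uE -mulrnA.
- apply: (@dvdn_of_int_mulrn _ _ (v n)).
  have -> : 54 * n + 52 = 6 * (3 * (3 * n + 2) + 2) + 4 by lia.
  by rewrite dpE vE -mulrnA.
Qed.
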